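(* Let $(\mathcal G,(\cdot,\cdot),\mathcal H)$ be an indecomposable generalized reductive Lie algebra with root system $R$, and let $R_t^0$, $\Lambda_t$ and $\dot R$ be as described in the context. Then the Lie algebra $\mathcal G_c/\mathcal Z(\mathcal G_c)$ (the core modulo its center) is a Lie torus of type $(\dot R,\Lambda_t)$.
   Context: Let $\mathcal G$ be a complex Lie algebra, $\mathcal H$ a subalgebra and $(\cdot,\cdot)$ a bilinear form on $\mathcal G$. Axioms: (GR1) $(\cdot,\cdot)$ is symmetric, nondegenerate and invariant. (GR2) $\mathcal H$ is a nontrivial finite-dimensional abelian subalgebra equal to its own centralizer in $\mathcal G$, and $\mathrm{ad}(h)$ is diagonalizable for all $h\in\mathcal H$. Then $\mathcal G=\bigoplus_{\alpha\in\mathcal H^*}\mathcal G_\alpha$ with $\mathcal G_\alpha=\{x:[h,x]=\alpha(h)x\ \forall h\in\mathcal H\}$; the root system is $R=\{\alpha\in\mathcal H^*:\mathcal G_\alpha\neq0\}$. The form is nondegenerate on $\mathcal H$; for $\alpha\in\mathcal H^*$ let $t_\alpha\in\mathcal H$ satisfy $(t_\alpha,h)=\alpha(h)$ for all $h$, and set $(\alpha,\beta):=(t_\alpha,t_\beta)$. Let $R^\times=\{\alpha\in R:(\alpha,\alpha)\ne0\}$, $R^0=\{\alpha\in R:(\alpha,\alpha)=0\}$. (GR3) For $\alpha\in R^\times$, $x\in\mathcal G_\alpha$, $\mathrm{ad}(x)$ is locally nilpotent on $\mathcal G$. (GR4) $R$ is discrete in $\mathcal H^*$. (GR5) $R^\times\neq\emptyset$.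 A triple satisfying GR1–GR5 is a generalized reductive Lie algebra (GRLA). It is indecomposable if $R^\times$ is not a disjoint union of two nonempty subsets orthogonal to each other with respect to $(\cdot,\cdot)$. The core $\mathcal G_c$ is the subalgebra generated by the $\mathcal G_\alpha$, $\alpha\in R^\times$; $\mathcal Z(\mathcal G_c)$ is its center. For a subset $S$ of a vector space, $\langle S\rangle$ denotes its $\mathbb Z$-span. Let $R_t^0=\{\delta\in R^0:\delta+\alpha\in R\text{ for some }\alpha\in R^\times\}$, $R_t=R^\times\cup R_t^0$, $\Lambda_t=\langle R_t^0\rangle$ and $\Lambda=\langle R^0\rangle$. It is known that $\Lambda_t$ is a free abelian group of finite rank and that there is an irreducible finite (possibly non-reduced) root system $\dot R\subseteq\mathcal H^*$ (a root system in its real span with respect to a nonzero scalar multiple of $(\cdot,\cdot)$) such that $R_t\subseteq\dot R+\Lambda_t$, $\dot R_{\mathrm{ind}}\subseteq R^\times\cup\{0\}$ where $\dot R_{\mathrm{ind}}=\{\dot\alpha\in\dot R:\tfrac12\dot\alpha\notin\dot R\}$, and $\langle R\rangle=\langle\dot R\rangle\oplus\Lambda$. Lie torus: for an irreducible finite root system $\dot R$ and a free abelian group $\Lambda$ of finite rank, a complex Lie algebra $\mathcal L$ is a Lie torus of type $(\dot R,\Lambda)$ if: (LT1) $\mathcal L=\bigoplus_{\dot\alpha\in\langle\dot R\rangle,\lambda\in\Lambda}\mathcal L^\lambda_{\dot\alpha}$ with $[\mathcal L^\lambda_{\dot\alpha},\mathcal L^\mu_{\dot\beta}]\subseteq\mathcal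 L^{\lambda+\mu}_{\dot\alpha+\dot\beta}$ and $\mathcal L^\lambda_{\dot\alpha}=0$ if $\dot\alpha\notin\dot R$; (LT2) for $\dot\alpha\in\dot R\setminus\{0\}$, $\lambda\in\Lambda$: (i) $\dim\mathcal L^\lambda_{\dot\alpha}\le1$, with $\dim\mathcal L^0_{\dot\alpha}=1$ if $\dot\alpha\in\dot R_{\mathrm{ind}}$; (ii) if $\dim\mathcal L^\lambda_{\dot\alpha}=1$ there are $e\in\mathcal L^\lambda_{\dot\alpha}$, $f\in\mathcal L^{-\lambda}_{-\dot\alpha}$ such that $h=[e,f]\in\mathcal L^0_0$ acts on every $x\in\mathcal L^\mu_{\dot\beta}$ ($\dot\beta\in\dot R,\mu\in\Lambda$) by $[h,x]=(\dot\beta,\dot\alpha^\vee)x$, the Cartan integer $2(\dot\beta,\dot\alpha)/(\dot\alpha,\dot\alpha)$; (LT3) for $\lambda\in\Lambda$, $\mathcal L^\lambda_0=\sum_{\dot\alpha\in\dot R\setminus\{0\},\mu\in\Lambda}[\mathcal L^\mu_{\dot\alpha},\mathcal L^{\lambda-\mu}_{-\dot\alpha}]$; (LT4) $\Lambda$ is generated by $\{\lambda\in\Lambda:\mathcal L^\lambda_{\dot\alpha}\ne0\text{ for some }\dot\alpha\in\dot R\}$. *)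

(* Defs.v *)
From mathcomp Require Import all_boot all_algebra.
From mathcomp.real_closed Require Import complex.
From mathcomp Require Import Rstruct.
From Stdlib Require Import ClassicalEpsilon.
Import GRing.Theory Num.Theory.
Set Implicit Arguments. Unset Strict Implicit. Unset Printing Implicit Defensive.
Local Open Scope ring_scope.

Definition C : numClosedFieldType := (Rdefinitions.R)[i].

Definition subsp (V : lmodType C) (S : V -> Prop) : Prop :=
  S 0 /\ forall (a : C) (x y : V), S x -> S y -> S (a *: x + y).

Definition dim_le1 (V : lmodType C) (S : V -> Prop) : Prop :=
  exists v : V, forall x, S x -> exists c : C, x = c *: v.
Definition dim_eq1 (V : lmodType C) (S : V -> Prop) : Prop :=
  dim_le1 S /\ exists x, S x /\ x <> 0.

Definition lin_map (U V : lmodType C) (f : U -> V) : Prop :=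
  forall (a : C) (u v : U), f (a *: u + v) = a *: f u + f v.

Definition is_lie (V : lmodType C) (br : V -> V -> V) : Prop :=
  (forall (a : C) x y z, br (a *: x + y) z = a *: br x z + br y z) /\
  (forall (a : C) x y z, br z (a *: x + y) = a *: br z x + br z y) /\
  (forall x, br x x = 0) /\
  (forall x y z, br x (br y z) + br y (br z x) + br z (br x y) = 0).

Section Fun.
Variable H : lmodType C.
Definition fzero : H -> C := fun _ => 0.
Definition fadd (f g : H -> C) : H -> C := fun h => f h + g h.
Definition fopp (f : H -> C) : H -> C := fun h => - f h.
Definition fsub (f g : H -> C) : H -> C := fun h => f h - g h.
Definition fhalf (f : H -> C) : H -> C := fun h => f h / 2%:R.
Definition is_lin (f : H -> C) : Prop :=
  forall (a : C) (u v : H), f (a *: u + v) = a * f u + f v.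

Definition zspan (S : (H -> C) -> Prop) (f : H -> C) : Prop :=
  exists s : seq ((H -> C) * int),
    (forall p, List.In p s -> S p.1) /\
    f = (fun h => \sum_(p <- s) (p.2)%:~R * p.1 h).

Definition zcomb (b : seq (H -> C)) (z : seq int) : H -> C :=
  fun h => \sum_(i < size b) (nth 0 z i)%:~R * (nth fzero b i) h.
Definition free_finite_rank (Lam : (H -> C) -> Prop) : Prop :=
  exists b : seq (H -> C),
    (forall l, Lam l <-> exists z : seq int, size z = size b /\ l = zcomb b z) /\
    (forall z1 z2 : seq int, size z1 = size b -> size z2 = size b ->
        zcomb b z1 = zcomb b z2 -> z1 = z2).

Definition cartan (form : (H -> C) -> (H -> C) -> C) (b a : H -> C) : C :=
  2%:R * form b a / form a a.

Definition fin_root_system (form : (H -> C) -> (H -> C) -> C) (S : seq (H -> C)) : Prop :=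
  (forall a, List.In a S -> is_lin a) /\
  List.In fzero S /\
  exists c : C, c <> 0 /\
    (forall a b, List.In a S -> List.In b S -> c * form a b \is Num.real) /\
    (forall r : seq ((H -> C) * C),
        (forall p, List.In p r -> List.In p.1 S /\ p.2 \is Num.real) ->
        let v := (fun h => \sum_(p <- r) p.2 * p.1 h) in
        0 <= c * form v v /\ (c * form v v = 0 -> v = fzero)) /\
    (forall a b, List.In a S -> List.In b S -> a <> fzero ->
        (exists z : int, cartan form b a = z%:~R) /\
        List.In (fun h => b h - cartan form b a * a h) S).

Definition irreducible_rs (form : (H -> C) -> (H -> C) -> C) (S : seq (H -> C)) : Prop :=
  ~ exists P Q : (H -> C) -> Prop,
      (forall a, (List.In a S /\ a <> fzero) <-> (P a \/ Q a)) /\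
      (forall a, ~ (P a /\ Q a)) /\
      (exists a, P a) /\ (exists a, Q a) /\
      (forall a b, P a -> Q b -> form a b = 0).

Definition is_dsum (K : Type) (L : lmodType C) (I : K -> Prop) (V : K -> L -> Prop) : Prop :=
  (forall x : L, exists s : seq (K * L),
      (forall p, List.In p s -> I p.1 /\ V p.1 p.2) /\ x = \sum_(p <- s) p.2) /\
  (forall s : seq (K * L), List.NoDup (map fst s) ->
      (forall p, List.In p s -> I p.1 /\ V p.1 p.2) ->
      \sum_(p <- s) p.2 = 0 -> forall p, List.In p s -> p.2 = 0).

Definition lie_torus (form : (H -> C) -> (H -> C) -> C) (Rd : seq (H -> C))
    (Lam : (H -> C) -> Prop) (L : lmodType C) (brL : L -> L -> L) : Prop :=
  free_finite_rank Lam /\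
  exists V : (H -> C) -> (H -> C) -> L -> Prop,
    (forall a l, subsp (V a l)) /\
    is_dsum (fun p : (H -> C) * (H -> C) => zspan (fun a => List.In a Rd) p.1 /\ Lam p.2)
            (fun p => V p.1 p.2) /\
    (forall a b l m x y, zspan (fun a => List.In a Rd) a -> zspan (fun a => List.In a Rd) b ->
        Lam l -> Lam m -> V a l x -> V b m y -> V (fadd a b) (fadd l m) (brL x y)) /\
    (forall a l x, zspan (fun a => List.In a Rd) a -> Lam l -> ~ List.In a Rd ->
        V a l x -> x = 0) /\
    (forall a l, List.In a Rd -> a <> fzero -> Lam l ->
       dim_le1 (V a l) /\
       (~ List.In (fhalf a) Rd -> dim_eq1 (V a fzero)) /\
       (dim_eq1 (V a l) ->
          exists e f, V a l e /\ V (fopp a) (fopp l) f /\ V fzero fzero (brL e f) /\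
            forall b m x, List.In b Rd -> Lam m -> V b m x ->
              brL (brL e f) x = cartan form b a *: x)) /\
    (forall l, Lam l -> forall x,
       V fzero l x <->
       exists s : seq (((H -> C) * (H -> C)) * (L * L)),
         (forall p, List.In p s ->
            List.In p.1.1 Rd /\ p.1.1 <> fzero /\ Lam p.1.2 /\
            V p.1.1 p.1.2 p.2.1 /\ V (fopp p.1.1) (fsub l p.1.2) p.2.2) /\
         x = \sum_(p <- s) brL p.2.1 p.2.2) /\
    (forall l, Lam l <->
       zspan (fun m => Lam m /\ exists a x, List.In a Rd /\ V a m x /\ x <> 0) l).
End Fun.
Arguments fzero {H}.

Section GRLA.
Variables (G : lmodType C) (H : vectType C) (br : G -> G -> G) (B : G -> G -> C)
          (iota : H -> G).

Definition rootsp (a : H -> C) (x : G) : Prop := forall h, br (iota h) x = a h *: x.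
Definition is_root (a : H -> C) : Prop := exists x, x <> 0 /\ rootsp a x.

Definition tvec (a : H -> C) : H :=
  epsilon (inhabits 0) (fun t : H => forall h, B (iota t) (iota h) = a h).
Definition dform (a b : H -> C) : C := B (iota (tvec a)) (iota (tvec b)).

Definition root_x (a : H -> C) : Prop := is_root a /\ dform a a <> 0.
Definition root_0 (a : H -> C) : Prop := is_root a /\ dform a a = 0.
Definition root_t0 (d : H -> C) : Prop :=
  root_0 d /\ exists a, root_x a /\ is_root (fadd d a).
Definition root_t (a : H -> C) : Prop := root_x a \/ root_t0 a.
Definition Lam_t : (H -> C) -> Prop := zspan root_t0.
Definition Lam_all : (H -> C) -> Prop := zspan root_0.

Definition is_GRLA : Prop :=
  is_lie br /\
  (forall (a : C) x y z, B (a *: x + y) z = a * B x z + B y z) /\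
  (forall (a : C) x y z, B z (a *: x + y) = a * B z x + B z y) /\
  (forall x y, B x y = B y x) /\
  (forall x, (forall y, B x y = 0) -> x = 0) /\
  (forall x y z, B (br x y) z = B x (br y z)) /\
  (* GR2: H is realised as the image of the finite-dimensional space H under iota *)
  lin_map iota /\ injective iota /\
  (exists h : H, h <> 0) /\
  (forall h h', br (iota h) (iota h') = 0) /\
  (forall x, (forall h, br (iota h) x = 0) -> exists h, x = iota h) /\
  (forall h x, exists s : seq (C * G),
      (forall p, List.In p s -> br (iota h) p.2 = p.1 *: p.2) /\ x = \sum_(p <- s) p.2) /\
  (forall a x, root_x a -> rootsp a x -> forall y, exists n, iter n (br x) y = 0) /\
  (* GR4: R is discrete in H^* (topology of pointwise convergence = usual topology) *)
  (forall a, is_root a -> exists (F : seq H) (e : C), 0 < e /\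
      forall b, is_root b -> (forall h, List.In h F -> `|b h - a h| < e) -> b = a) /\
  (exists a, root_x a).

Definition indecomposable : Prop :=
  ~ exists P Q : (H -> C) -> Prop,
      (forall a, root_x a <-> (P a \/ Q a)) /\
      (forall a, ~ (P a /\ Q a)) /\
      (exists a, P a) /\ (exists a, Q a) /\
      (forall a b, P a -> Q b -> dform a b = 0).

Definition is_subalg (S : G -> Prop) : Prop :=
  subsp S /\ forall x y, S x -> S y -> S (br x y).
Definition core (x : G) : Prop :=
  forall S : G -> Prop, is_subalg S ->
    (forall a y, root_x a -> rootsp a y -> S y) -> S x.
Definition core_center (x : G) : Prop :=
  core x /\ forall y, core y -> br x y = 0.

Definition Rdot_ok (Rd : seq (H -> C)) : Prop :=
  fin_root_system dform Rd /\ irreducible_rs dform Rd /\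
  (forall a, root_t a -> exists b l, List.In b Rd /\ Lam_t l /\ a = fadd b l) /\
  (forall a, List.In a Rd -> ~ List.In (fhalf a) Rd -> root_x a \/ a = fzero) /\
  (forall f, zspan is_root f <->
      exists b l, zspan (fun b => List.In b Rd) b /\ Lam_all l /\ f = fadd b l) /\
  (forall f, zspan (fun b => List.In b Rd) f -> Lam_all f -> f = fzero).

(** pi : G -> L restricts to a surjection G_c ->> L of Lie algebras with kernel
    Z(G_c); i.e. (L, brL) is (a copy of) G_c / Z(G_c). *)
Definition is_core_mod_center (L : lmodType C) (brL : L -> L -> L) (pi : G -> L) : Prop :=
  is_lie brL /\ lin_map pi /\
  (forall x y, core x -> core y -> pi (br x y) = brL (pi x) (pi y)) /\
  (forall l, exists x, core x /\ pi x = l) /\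
  (forall x, core x -> (pi x = 0 <-> core_center x)).
End GRLA.

(* Main.v *)
Require Import Defs.
From mathcomp Require Import all_boot all_order all_algebra ring lra zify.
From mathcomp.real_closed Require Import complex.
From mathcomp Require Import Rstruct.
From Stdlib Require Import ClassicalEpsilon FunctionalExtensionality.
Import Order.TTheory GRing.Theory Num.Theory.
Local Open Scope ring_scope.

(* Isotropic roots are orthogonal to the nonisotropic ones: otherwise, the Heisenberg algebra
   of an isotropic root d forces the string a + Z d to be infinite in one direction, where
   the Cartan integers fail to be integers. Hence the core is spanned by the one-dimensional
   G_a, a nonisotropic, and by the brackets [G_a, G_b] with a + b isotropic, so that all its
   weights lie in R_t. Since the sum of <Rd> and Lam_t is direct, each weight is uniquely
   a + l, which grades the core; the centre of the core is a graded subspace, so the grading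
   passes to the quotient, and sl2-triples of G give those of the Lie torus.

   Lam_t is free of finite rank because it is discrete. For a nonisotropic root a in Rd, the
   set S_a of all l in Lam_t with a + l a root satisfies 2<S_a> <= S_a by reflections, so
   discreteness of R at a makes <S_a> discrete; irreducibility of Rd provides a nonzero N with
   N Lam_t <= <S_a>. *)

Set Implicit Arguments. Unset Strict Implicit. Unset Printing Implicit Defensive.

Notation R := Rdefinitions.R.
Ltac fext := apply: functional_extensionality => ?; rewrite /fadd /fopp /fsub /fhalf /fzero.

Lemma In_nth (T : Type) (x0 : T) s i : (i < size s)%N -> List.In (nth x0 s i) s.
Proof. by elim: s i => //= a l IH [|k] lk; [left|right; apply: IH]. Qed.

(** * Discrete groups of functions are free *)

Section Lattice.
Variable H : lmodType C.
Implicit Types f g : H -> C.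

Definition faddz f (k : int) g : H -> C := fun h => f h + k%:~R * g h.

Lemma zcomb_nil : zcomb [::] [::] = @fzero H.
Proof. by apply: functional_extensionality => h; rewrite /zcomb big_ord0. Qed.

Lemma zcomb_cons g b k z :
  zcomb (g :: b) (k :: z) = faddz (zcomb b z) k g.
Proof. by apply: functional_extensionality => h; rewrite /zcomb /faddz /= big_ord_recl addrC. Qed.

Definition fscale (k : C) f : H -> C := fun h => k * f h.

Definition zadditive (phi : (H -> C) -> R) :=
  forall f k g, phi (faddz f k g) = phi f + k%:~R * phi g.

(** The harmonic bound [3 * M / (3 + w)] survives a step of ratio 3/4, since 3/4 (4 + w) <= 3 + w.
    It is weaker than a geometric bound, but the Archimedean property alone makes it small. *)
Lemma descent_step (x y w M : R) : 0 <= x -> 0 <= w ->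
  x * (3 + w) <= 3 * M -> y < 3 / 4 * x -> y * (3 + (w + 1)) <= 3 * M.
Proof.
move=> x0 w0 xM yx.
have : 0 <= (3 / 4 * x - y) * w by rewrite mulr_ge0 // subr_ge0 ltW.
by have := mulr_ge0 x0 w0; lra.
Qed.

Lemma small_of_bound (e x w M : R) : 0 < e -> 0 <= x -> 0 <= w ->
  3 * M / e < w -> x * (3 + w) <= 3 * M -> x < e.
Proof.
move=> e0 x0 w0; rewrite ltr_pdivrMr // => Mw xM; rewrite ltNge; apply/negP => ex.
have : 0 <= (x - e) * w by rewrite mulr_ge0 // subr_ge0.
by lra.
Qed.

Lemma add_mul_small (x y z w : R) : 0 <= x -> 0 <= y -> x <= 1 ->
  y <= w / 2 -> z < w / 4 -> z + x * y < 3 / 4 * w.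
Proof. by move=> x0 y0 x1; have := ler_wpM2r y0 x1; lra. Qed.

Lemma exists_argmax n (phi : 'I_n.+1 -> R) : exists i, forall j, phi j <= phi i.
Proof.
exists [arg max_(i > ord0 | xpredT i) phi i]%O => j.
by case: arg_maxP => // i _; apply.
Qed.

Variable Gam : (H -> C) -> Prop.
Hypothesis Gam_add : forall f k g, Gam f -> Gam g -> Gam (faddz f k g).

Let zs b g := exists z : seq int, size z = size b /\ g = zcomb b z.

(** A minimum over the elements outside [Y] need not be at hand, so the sup norm of the [phi j] is
    minimised only up to the factor 3/4. If no element qualified, repeated descent by this factor
    would end below [e], where everything lies in [Y]. *)
Lemma approx_minimal n (phi : 'I_n.+1 -> (H -> C) -> R) (e : R) (Y : (H -> C) -> Prop) :
  0 < e -> (exists g, Gam g /\ ~ Y g) ->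
  (forall g, Gam g -> (forall i, `|phi i g| < e) -> Y g) ->
  exists g i, Gam g /\ ~ Y g /\ (forall j, `|phi j g| <= `|phi i g|) /\
    forall g', Gam g' -> (forall j, `|phi j g'| < 3%:R / 4%:R * `|phi i g|) -> Y g'.
Proof.
move=> e0 [g1 [Gg1 Yg1]] disc; apply: NNPP => Hn.
have [i1 m1] := exists_argmax (fun i => `|phi i g1|).
set M := `|phi i1 g1| in m1.
have step k : exists g, Gam g /\ ~ Y g /\ forall j, `|phi j g| * (3 + k%:R) <= 3 * M.
  elim: k => [|k [g [Gg [Yg gM]]]].
    by exists g1; split=> //; split=> // j; have := m1 j; lra.
  have [i mi] := exists_argmax (fun i => `|phi i g|).
  apply: NNPP => Hk; apply: Hn; exists g, i; split=> //; split=> //; split=> //.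
  move=> g' Gg' small; apply: NNPP => Yg'; apply: Hk; exists g'; split=> //; split=> // j.
  rewrite -[k.+1]addn1 natrD.
  by apply: descent_step (gM i) (small j); rewrite ?normr_ge0 ?ler0n.
have M0 : 0 <= 3 * M / e by rewrite divr_ge0 ?mulr_ge0 ?normr_ge0 ?ler0n // ltW.
have [g [Gg [Yg gM]]] := step (Num.bound (3 * M / e)).
apply: Yg; apply: disc => // i.
exact: small_of_bound e0 (normr_ge0 _) (ler0n _ _) (archi_boundP M0) (gM i).
Qed.

Lemma round_quotient (x y : R) : y != 0 -> exists m : int, `|x - m%:~R * y| <= `|y| / 2.
Proof.
move=> y0; exists (Num.floor (x / y + 1 / 2)).
have := Num.Theory.floor_itv (x / y + 1 / 2); move: (Num.floor _) => m.
rewrite intrD => /andP[m1 m2].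
have -> : x - m%:~R * y = (x / y - m%:~R) * y by field.
rewrite normrM mulrC ler_pM2l ?normr_gt0 //.
by rewrite ler_norml; lra.
Qed.

(** Induction on the number of functionals. The list [b] is the basis built so far, killed by all
    [phi i], and elements on which every [phi i] is small already lie in its span. Each round adds
    one basis vector [g0] and eliminates one functional. *)
Lemma discrete_free_finite_rank_rel n (phi : 'I_n -> (H -> C) -> R) (e : R) (b : seq (H -> C)) :
  0 < e -> (forall i, zadditive (phi i)) ->
  (forall z, size z = size b -> Gam (zcomb b z)) ->
  (forall i z, size z = size b -> phi i (zcomb b z) = 0) ->
  (forall z1 z2, size z1 = size b -> size z2 = size b ->
        zcomb b z1 = zcomb b z2 -> z1 = z2) ->
  (forall g, Gam g -> (forall i, `|phi i g| < e) -> zs b g) ->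
  free_finite_rank Gam.
Proof.
elim: n phi e b => [|n IH] phi e b e0 lin bG b0 binj disc.
  exists b; split=> // l; split; last by move=> [z [sz ->]]; exact: bG.
  by move=> Gl; apply: disc => // -[].
case: (classic (exists g, Gam g /\ ~ zs b g)) => [out|nout]; last first.
  exists b; split=> // l; split; last by move=> [z [sz ->]]; exact: bG.
  by move=> Gl; apply: NNPP => zl; apply: nout; exists l.
have [g0 [i [Gg0 [zg0 [gmax gmin]]]]] := approx_minimal e0 out disc.
have A0 : 0 < `|phi i g0|.
  rewrite lt_def normr_ge0 andbT; apply/eqP => A0; apply: zg0; apply: disc => // j.
  by apply: le_lt_trans (gmax j) _; rewrite A0.
have p0 : phi i g0 != 0 by rewrite -normr_gt0.
(* The remaining functionals are corrected by multiples of [phi i] so that they vanish on [g0]. The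
   slopes have modulus at most 1 because coordinate [i] of [g0] is the largest. *)
pose r j := phi (lift i j) g0 / phi i g0.
have r1 j : `|r j| <= 1 by rewrite normrM normfV ler_pdivrMr // mul1r; apply: gmax.
pose psi j g := phi (lift i j) g - r j * phi i g.
have psilin j : zadditive (psi j) by move=> f k g; rewrite /psi !lin; ring.
have psi0 j : psi j g0 = 0 by rewrite /psi /r; field.
apply: (IH psi (`|phi i g0| / 4) (g0 :: b)) => //.
- by rewrite divr_gt0 // ltr0n.
- by case=> // k z [sz]; rewrite zcomb_cons; apply: Gam_add => //; apply: bG.
- by move=> j [] // k z [sz]; rewrite zcomb_cons psilin psi0 /psi !b0 // !mulr0 subr0 addr0.
- case=> // k1 z1 [] // k2 z2 [s1] [s2]; rewrite !zcomb_cons => E.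
  have := congr1 (phi i) E; rewrite !lin !b0 // !add0r => /(mulIf p0) /intr_inj k12.
  rewrite k12 in E *; congr (_ :: _); apply: binj => //.
  apply: functional_extensionality => h; have := congr1 (fun f => f h) E.
  by rewrite /faddz => /addIr.
- move=> g Gg small.
  (* Subtracting the nearest multiple of [g0] leaves coordinate [i] at most 1/2 of [phi i g0] in
     modulus, and the others below 1/4 + 1/2 = 3/4 of it. The choice of [g0] then puts the remainder
     in the span of [b]. *)
  have [m mP] := round_quotient (phi i g) p0.
  have : zs b (faddz g (- m) g0).
    apply: gmin; first exact: Gam_add.
    have Hi : `|phi i (faddz g (- m) g0)| <= `|phi i g0| / 2.
      by rewrite lin rmorphN mulNr.
    move=> j; case: (unliftP i j) => [j'|] ->; last by lra.
    have -> : phi (lift i j') (faddz g (- m) g0) =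
        psi j' g + r j' * phi i (faddz g (- m) g0).
      have := psilin j' g (- m) g0; rewrite psi0 mulr0 addr0 => <-.
      by rewrite /psi; ring.
    apply: le_lt_trans (ler_normD _ _) _; rewrite normrM.
    exact: add_mul_small (normr_ge0 _) (normr_ge0 _) (r1 j') Hi (small j').
  move=> [z [sz zE]]; exists (m :: z); split; first by rewrite /= sz.
  rewrite zcomb_cons -zE; fext; rewrite /faddz rmorphN; ring.
Qed.

Lemma normC_lt (z e : C) : 0 < e -> `|complex.Re z| < complex.Re e / 2 ->
  `|complex.Im z| < complex.Re e / 2 -> `|z| < e.
Proof.
rewrite ltcE /= => /andP[/eqP e0 _] rz iz.
rewrite normc_def ltcE /= e0 eqxx /=.
have e1 : 0 < complex.Re e by have := normr_ge0 (complex.Re z); lra.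
rewrite -[ltRHS]ger0_norm ?ltW // -sqrtr_sqr ltr_sqrt ?exprn_gt0 //.
rewrite -[complex.Re z ^+ 2]real_normK ?num_real // -[complex.Im z ^+ 2]real_normK ?num_real //.
have := normr_ge0 (complex.Re z); have := normr_ge0 (complex.Im z).
move: `|complex.Re z| `|complex.Im z| (complex.Re e) rz iz e1 => x y w.
by rewrite !expr2; nra.
Qed.

(** The real and imaginary parts of the evaluations at [F] serve as the additive functionals,
    starting from the empty basis. Bounding both parts by half of [e] bounds the modulus by [e]. *)
Lemma discrete_free_finite_rank (F : seq H) (e : C) :
  Gam fzero -> 0 < e ->
  (forall g, Gam g -> (forall h, List.In h F -> `|g h| < e) -> g = fzero) ->
  free_finite_rank Gam.
Proof.
move=> G0 e0 disc.
pose re h (f : H -> C) : R := complex.Re (f h).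
pose im h (f : H -> C) : R := complex.Im (f h).
pose fs := map re F ++ map im F.
pose phi (i : 'I_(size fs)) := nth (fun _ => 0) fs i.
have fsmem a : List.In a fs -> exists i, phi i = a.
  rewrite /phi; elim: (fs) => //= b l IH [<-|/IH [i <-]]; first by exists ord0.
  by exists (lift ord0 i).
have [e1 eR] : complex.Im e = 0 /\ 0 < complex.Re e.
  by move: e0; rewrite ltcE /= => /andP[/eqP ->].
apply: (@discrete_free_finite_rank_rel _ phi (complex.Re e / 2) [::]) => //.
- by rewrite divr_gt0 // ltr0n.
- move=> i; have := In_nth (fun _ => 0) (ltn_ord i); rewrite -/(phi i).
  case/(@List.in_app_or _ _ _ _) => /List.in_map_iff [h [<- _]] f k g;
    rewrite /re /im /faddz.
  + have -> : (k%:~R : C) = (k%:~R : R)%:C%C by rewrite rmorph_int.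
    by case: (f h) (g h) => [a b] [c d] /=; ring.
  + have -> : (k%:~R : C) = (k%:~R : R)%:C%C by rewrite rmorph_int.
    by case: (f h) (g h) => [a b] [c d] /=; ring.
- by case=> // _; rewrite zcomb_nil.
- move=> i [] // _; rewrite zcomb_nil.
  have := In_nth (fun _ => 0) (ltn_ord i); rewrite -/(phi i).
  by case/(@List.in_app_or _ _ _ _) => /List.in_map_iff [h [<- _]].
- by case=> // -[].
- move=> g Gg small; exists [::]; split=> //.
  rewrite zcomb_nil.
  apply: disc => // h Fh; apply: normC_lt => //.
  + have [|i iE] := fsmem (re h).
      by apply/List.in_or_app; left; apply/List.in_map_iff; exists h.
    by have := small i; rewrite iE.
  + have [|i iE] := fsmem (im h).
      by apply/List.in_or_app; right; apply/List.in_map_iff; exists h.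
    by have := small i; rewrite iE.
Qed.
End Lattice.

(** * Integer spans of sets of functions *)

Section Zspan.
Variable H : lmodType C.
Implicit Types (S : (H -> C) -> Prop) (f g : H -> C).

Lemma zspan_ind S (P : (H -> C) -> Prop) f : P fzero ->
  (forall g k u, P g -> S u -> P (faddz g k u)) -> zspan S f -> P f.
Proof.
move=> P0 Pa [s [Ss ->]]; elim: s Ss => [|p s IH] Ss.
  by have -> : (fun h => \sum_(p <- [::]) (p.2 : int)%:~R * p.1 h) = @fzero H
    by apply: functional_extensionality => h; rewrite big_nil.
have -> : (fun h => \sum_(q <- p :: s) q.2%:~R * q.1 h) =
    faddz (fun h => \sum_(q <- s) q.2%:~R * q.1 h) p.2 p.1.
  by apply: functional_extensionality => h; rewrite big_cons addrC.
apply: Pa; last by apply: Ss; left.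
by apply: IH => q qs; apply: Ss; right.
Qed.

Lemma zspan0 S : zspan S fzero.
Proof. by exists [::]; split=> //; apply: functional_extensionality => h; rewrite big_nil. Qed.

Lemma zspan_add_gen S f k g : zspan S f -> S g -> zspan S (faddz f k g).
Proof.
move=> [s [Ss ->]] Sg; exists ((g, k) :: s); split=> [p [<- //|/Ss //]|].
by apply: functional_extensionality => h; rewrite big_cons addrC.
Qed.

Lemma zspan_gen S f : S f -> zspan S f.
Proof.
move=> Sf; have -> : f = faddz fzero 1 f by fext; rewrite /faddz; ring.
by apply: zspan_add_gen => //; apply: zspan0.
Qed.

Lemma zspan_add S f k g : zspan S f -> zspan S g -> zspan S (faddz f k g).
Proof.
move=> Sf; elim/zspan_ind => [|u m v IH Sv].
  by have -> : faddz f k fzero = f by fext; rewrite /faddz; ring.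
have -> : faddz f k (faddz u m v) = faddz (faddz f k u) (k * m) v.
  by fext; rewrite /faddz rmorphM; ring.
exact: zspan_add_gen.
Qed.

Lemma zspan_sub S S' f : (forall g, S g -> zspan S' g) -> zspan S f -> zspan S' f.
Proof.
move=> SS'; elim/zspan_ind => [|g k u IH Su]; first exact: zspan0.
by apply: zspan_add => //; apply: SS'.
Qed.

Lemma zspanD S f g : zspan S f -> zspan S g -> zspan S (fadd f g).
Proof.
move=> Sf Sg; have -> : fadd f g = faddz f 1 g by fext; rewrite /faddz; ring.
exact: zspan_add.
Qed.

Lemma zspanB S f g : zspan S f -> zspan S g -> zspan S (fsub f g).
Proof.
move=> Sf Sg; have -> : fsub f g = faddz f (-1) g by fext; rewrite /faddz; ring.
exact: zspan_add.
Qed.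

Lemma zspan_scale S k f : zspan S f -> zspan S (fscale k%:~R f).
Proof.
move=> Sf; have -> : fscale k%:~R f = faddz fzero k f by fext; rewrite /faddz /fscale; ring.
by apply: zspan_add => //; apply: zspan0.
Qed.
End Zspan.

Lemma int_mul_eq1 (u v : int) : u * v = 1 -> v = 1 \/ v = -1.
Proof. by move/(congr1 absz); rewrite abszM => /eqP; rewrite muln_eq1 => /andP[_ /eqP]; lia. Qed.

(** * Weight vectors *)

Section LinMap.
Variables (U V : lmodType C) (f : U -> V).
Hypothesis fl : lin_map f.
Lemma lin_mapD u v : f (u + v) = f u + f v.
Proof. by have := fl 1 u v; rewrite !scale1r. Qed.
Lemma lin_map0 : f 0 = 0.
Proof. by apply: (addIr (f 0)); rewrite -lin_mapD !add0r. Qed.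
Lemma lin_mapZ a u : f (a *: u) = a *: f u.
Proof. by have := fl a u 0; rewrite !addr0 lin_map0 addr0. Qed.
Lemma lin_mapN u : f (- u) = - f u.
Proof. by rewrite -scaleN1r lin_mapZ scaleN1r. Qed.
Lemma lin_map_sum (I : Type) (s : seq I) (F : I -> U) :
  f (\sum_(i <- s) F i) = \sum_(i <- s) f (F i).
Proof. by elim: s => [|a s IH]; rewrite ?big_nil ?lin_map0 // !big_cons lin_mapD IH. Qed.
End LinMap.

Section Subspace.
Variables (V : lmodType C) (P : V -> Prop).
Hypothesis Ps : subsp P.
Lemma subsp0 : P 0. Proof. by case: Ps. Qed.
Lemma subspD x y : P x -> P y -> P (x + y).
Proof. by move=> Px Py; rewrite -[x]scale1r; apply: (proj2 Ps). Qed.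
Lemma subspZ a x : P x -> P (a *: x).
Proof. by move=> Px; rewrite -[_ *: x]addr0; apply: (proj2 Ps) => //; apply: subsp0. Qed.
Lemma subsp_sum (I : Type) (s : seq I) (F : I -> V) :
  (forall i, List.In i s -> P (F i)) -> P (\sum_(i <- s) F i).
Proof.
elim: s => [|a s IH] Fs; first by rewrite big_nil; apply: subsp0.
rewrite big_cons; apply: subspD; first by apply: Fs; left.
by apply: IH => i Fi; apply: Fs; right.
Qed.
End Subspace.

(* Repeatedly applying [T k - b k] kills the summands of weight [b] one after the other. *)
Lemma weight_component (K : Type) (G : lmodType C) (T : K -> G -> G) (P : G -> Prop)
    (a : K -> C) (v : G) (s : seq ((K -> C) * G)) :
  (forall k, lin_map (T k)) -> subsp P -> (forall k x, P x -> P (T k x)) ->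
  (forall k, T k v = a k *: v) ->
  (forall p, List.In p s -> p.1 <> a /\ forall k, T k p.2 = p.1 k *: p.2) ->
  P (v + \sum_(p <- s) p.2) -> P v.
Proof.
move=> Tl Ps PT; move: v; have [n] := ubnP (size s).
elim: n s => // n IH [|[b w] s] /= sn v av sw; first by rewrite big_nil addr0.
rewrite big_cons /= => Pv.
have [ba bw] := sw (b, w) (or_introl erefl).
have [k kP] : exists k, b k <> a k.
  apply: NNPP => nk; apply: ba; apply: functional_extensionality => k /=.
  by apply: NNPP => nk'; apply: nk; exists k.
have nz : a k - b k != 0 by rewrite subr_eq0; apply/eqP => /esym.
rewrite -[v](scalerK nz); apply: subspZ => //.
apply: (IH [seq (p.1, (p.1 k - b k) *: p.2) | p <- s]).
- by rewrite size_map; move: sn; rewrite ltnS.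
- by move=> k'; rewrite lin_mapZ // av !scalerA mulrC.
- move=> p /List.in_map_iff [q [<- qs]] /=.
  have [qa qw] := sw q (or_intror qs); split=> // k'.
  by rewrite lin_mapZ // qw !scalerA mulrC.
suff -> : (a k - b k) *: v + \sum_(p <- [seq (p.1, (p.1 k - b k) *: p.2) | p <- s]) p.2 =
    (- b k) *: (v + (w + \sum_(p <- s) p.2)) + T k (v + (w + \sum_(p <- s) p.2)).
  by apply: (proj2 Ps) => //; apply: PT.
rewrite !(lin_mapD (Tl k)) (lin_map_sum (Tl k)) av bw big_map /=.
have -> : \sum_(p <- s) T k p.2 = \sum_(p <- s) p.1 k *: p.2.
  have {}sw p : List.In p s -> T k p.2 = p.1 k *: p.2 by move=> ps; have [] := sw p (or_intror ps).
  elim: (s) sw => [|q t IHt] tw; rewrite ?big_nil // !big_cons tw; last by left.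
  by rewrite IHt // => p pt; apply: tw; right.
under eq_bigr do rewrite scalerBl.
rewrite big_split /= sumrN -scaler_sumr !scalerDr scalerBl !scaleNr.
by rewrite [RHS]addrACA [X in _ = _ + X]addrACA addNr add0r (addrC (- (b k *: v)))
  (addrC (- (b k *: \sum_(_ <- _) _))).
Qed.

Lemma sum_partition (K : Type) (V : lmodType C) (a : K) (s : seq (K * V)) :
  exists s1 s2 : seq (K * V),
    (forall p, List.In p s1 -> List.In p s /\ p.1 = a) /\
    (forall p, List.In p s2 -> List.In p s /\ p.1 <> a) /\
    \sum_(p <- s) p.2 = \sum_(p <- s1) p.2 + \sum_(p <- s2) p.2.
Proof.
elim: s => [|q s [s1 [s2 [S1 [S2 SE]]]]].
  by exists [::], [::]; rewrite !big_nil addr0.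
case: (classic (q.1 = a)) => qa.
- exists (q :: s1), s2; split; last split.
  + by move=> p [<-|/S1 [ps pa]]; split=> //; [left|right].
  + by move=> p /S2 [ps pa]; split=> //; right.
  + by rewrite !big_cons SE addrA.
- exists s1, (q :: s2); split; last split.
  + by move=> p /S1 [ps pa]; split=> //; right.
  + by move=> p [<-|/S2 [ps pa]]; split=> //; [left|right].
  + by rewrite !big_cons SE addrCA.
Qed.

(** * Generalized reductive Lie algebras *)

Section Lie.
Variables (G : lmodType C) (H : vectType C) (br : G -> G -> G) (B : G -> G -> C)
          (iota : H -> G).
Hypothesis hG : is_GRLA br B iota.
Notation rootsp := (rootsp br iota).
Notation is_root := (is_root br iota).
Notation dform := (dform B iota).
Notation tvec := (tvec B iota).
Notation root_x := (root_x br B iota).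
Notation root_0 := (root_0 br B iota).
Implicit Types (a b c g : H -> C) (x y z e f w : G) (h : H).

Lemma br_lie : is_lie br. Proof. by case: hG. Qed.
Lemma br_linr x : lin_map (br x).
Proof. by move=> a u v; case: br_lie => _ []. Qed.
Lemma br_linl x : lin_map (br^~ x).
Proof. by move=> a u v; case: br_lie. Qed.
Lemma brxx x : br x x = 0.
Proof. by case: br_lie => _ [_ []]. Qed.
Lemma brC x y : br x y = - br y x.
Proof.
have := brxx (x + y); rewrite (lin_mapD (br_linl _)) !(lin_mapD (br_linr _)) !brxx.
by rewrite addr0 add0r => /addr0_eq <-; rewrite ?opprK.
Qed.
Lemma br_jacobi x y z : br x (br y z) = br (br x y) z + br y (br x z).
Proof.
case: br_lie => _ [_ [_ jac]]; have := jac x y z.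
rewrite (brC z (br x y)) (brC z x) (lin_mapN (br_linr _)).
by move/eqP; rewrite subr_eq0 => /eqP <-; rewrite subrK.
Qed.

Lemma B_linr x : @lin_map _ (C^o) (B x).
Proof. by move=> a u v; case: hG => _ [_ []]. Qed.
Lemma B_sym x y : B x y = B y x.
Proof. by case: hG => _ [_ [_ []]]. Qed.
Lemma B_linl x : @lin_map _ (C^o) (B^~ x).
Proof. by move=> a u v; case: hG => _ []. Qed.
Lemma B_nondeg x : x <> 0 -> exists y, B x y <> 0.
Proof.
case: hG => _ [_ [_ [_ [nd _]]]] x0; apply: NNPP => ny; apply: x0; apply: nd => y.
by apply: NNPP => nz; apply: ny; exists y.
Qed.
Lemma B_inv x y z : B (br x y) z = B x (br y z).
Proof. by case: hG => _ [_ [_ [_ [_ []]]]]. Qed.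
Lemma iota_lin : lin_map iota.
Proof. by case: hG => _ [_ [_ [_ [_ [_ []]]]]]. Qed.
Lemma iota_inj : injective iota.
Proof. by case: hG => _ [_ [_ [_ [_ [_ [_ []]]]]]]. Qed.
Lemma brH h h' : br (iota h) (iota h') = 0.
Proof. by case: hG => _ [_ [_ [_ [_ [_ [_ [_ [_ []]]]]]]]]. Qed.
Lemma centralizer_H x : (forall h, br (iota h) x = 0) -> exists h, x = iota h.
Proof. by case: hG => _ [_ [_ [_ [_ [_ [_ [_ [_ [_ []]]]]]]]]] ch _; apply: ch. Qed.
Lemma adH_diag h x : exists s : seq (C * G),
  (forall p, List.In p s -> br (iota h) p.2 = p.1 *: p.2) /\ x = \sum_(p <- s) p.2.
Proof. by case: hG => _ [_ [_ [_ [_ [_ [_ [_ [_ [_ [_ []]]]]]]]]]]. Qed.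
Lemma ad_nilp a x y : root_x a -> rootsp a x -> exists n, iter n (br x) y = 0.
Proof.
case: hG => _ [_ [_ [_ [_ [_ [_ [_ [_ [_ [_ [_ [nl _]]]]]]]]]]]] ra rx.
exact: nl ra rx _.
Qed.
Lemma root_discrete a : is_root a -> exists (F : seq H) (e : C), 0 < e /\
      forall b, is_root b -> (forall h, List.In h F -> `|b h - a h| < e) -> b = a.
Proof. by case: hG => _ [_ [_ [_ [_ [_ [_ [_ [_ [_ [_ [_ [_ [di _]]]]]]]]]]]]]; apply: di. Qed.
Lemma root_x_nonempty : exists a, root_x a.
Proof. by case: hG => _ [_ [_ [_ [_ [_ [_ [_ [_ [_ [_ [_ [_ [_ ]]]]]]]]]]]]]. Qed.

Lemma rootsp_subsp a : subsp (rootsp a).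
Proof.
split=> [h|k x y xa ya h]; first by rewrite (lin_map0 (br_linr _)) scaler0.
by rewrite br_linr xa ya scalerDr !scalerA mulrC.
Qed.

Lemma rootsp_br a b x y : rootsp a x -> rootsp b y -> rootsp (fadd a b) (br x y).
Proof.
move=> xa yb h; rewrite br_jacobi xa yb (lin_mapZ (br_linr _)).
by rewrite (lin_mapZ (br_linl _)) -scalerDl.
Qed.

Lemma rootsp_linear a x : x <> 0 -> rootsp a x -> is_lin a.
Proof.
move=> x0 xa k u v; have := xa (k *: u + v).
rewrite iota_lin br_linl !xa scalerA -scalerDl => /esym/eqP.
rewrite -subr_eq0 -scalerBl scaler_eq0 subr_eq0 => /orP[/eqP //|/eqP].
by move/x0.
Qed.

Lemma root_lin a : is_root a -> is_lin a.
Proof. by case=> x [x0 xa]; apply: rootsp_linear xa. Qed.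

Lemma fopp_lin a : is_lin a -> is_lin (fopp a).
Proof. by move=> la k u v; rewrite /fopp la; ring. Qed.

Lemma lin_coord a h : is_lin a ->
  a h = \sum_i coord (vbasis fullv) i h * a (vbasis fullv)`_i.
Proof.
move=> la; rewrite [in LHS](coord_vbasis (memvf h)).
have a0 : a 0 = 0 by apply: (addIr (a 0)); rewrite -{1}[a 0]mul1r -la scaler0 !add0r.
by elim/big_rec2: _ => // i y1 y2 _ <-; rewrite la.
Qed.

Lemma rootsp_basis a x : is_lin a ->
  (forall i : 'I_(\dim (fullv : {vspace H})),
     br (iota (vbasis fullv)`_i) x = a (vbasis fullv)`_i *: x) -> rootsp a x.
Proof.
move=> la xb h; rewrite (lin_coord h la) {1}(coord_vbasis (memvf h)).
rewrite (lin_map_sum iota_lin) (lin_map_sum (br_linl x)) scaler_suml.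
apply: eq_bigr => i _.
by rewrite (lin_mapZ iota_lin) (lin_mapZ (br_linl x)) xb scalerA.
Qed.

Lemma B_eigen_orth k1 k2 h x y : br (iota h) x = k1 *: x -> br (iota h) y = k2 *: y ->
  k2 <> - k1 -> B x y = 0.
Proof.
move=> xk yk ne; have := B_inv x (iota h) y.
rewrite (brC x) xk yk (lin_mapN (B_linl y)) (lin_mapZ (B_linl y)) (lin_mapZ (B_linr x)) => /eqP.
rewrite eq_sym -addr_eq0 -scalerDl scaler_eq0 addr_eq0 => /orP[/eqP //|/eqP //].
Qed.

(** A vector [y] with [B x y] nonzero is projected, one basis element [h] at a time, to the
    eigenspace of ad [h] for [- a h]. The discarded parts are orthogonal to [x] by invariance, so
    the pairing stays nonzero. *)
Lemma rootsp_pairing a x : x <> 0 -> rootsp a x -> exists y, rootsp (fopp a) y /\ B x y <> 0.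
Proof.
move=> x0 xa; have la := rootsp_linear x0 xa.
have fin (l : seq H) :
    exists y, (forall h, List.In h l -> br (iota h) y = - a h *: y) /\ B x y <> 0.
  elim: l => [|h l [y [yl xy]]]; first by have [y] := B_nondeg x0; exists y.
  have [s [sh sy]] := adH_diag h y.
  have [s1 [s2 [S1 [S2 SE]]]] := sum_partition (- a h) s.
  exists (\sum_(p <- s1) p.2).
  have eig : br (iota h) (\sum_(p <- s1) p.2) = - a h *: \sum_(p <- s1) p.2.
    rewrite (lin_map_sum (br_linr _)) scaler_sumr.
    elim: (s1) S1 => [|q t IHt] S1; rewrite ?big_nil // !big_cons.
    have [qs qa] := S1 q (or_introl erefl).
    by rewrite sh // qa IHt // => p pt; apply: S1; right.
  split; last first.
    move: xy; rewrite sy SE (lin_mapD (B_linr _)) (lin_map_sum (B_linr _) s2).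
    suff -> : \sum_(p <- s2) B x p.2 = 0 by rewrite addr0.
    elim: (s2) S2 => [|q t IHt] S2; rewrite ?big_nil // !big_cons.
    have [qs qa] := S2 q (or_introl erefl).
    rewrite (B_eigen_orth (xa h) (sh q qs) qa) add0r.
    by apply: IHt => p pt; apply: S2; right.
  move=> h' [<- //|]; move: h'.
  (* The projection keeps the eigenvalue conditions already obtained: they cut out a subspace stable
     under ad [h], and such a subspace contains the eigencomponents of its elements. *)
  pose P u := forall h', List.In h' l -> br (iota h') u = - a h' *: u.
  apply: (@weight_component unit G (fun _ => br (iota h)) P (fun _ => - a h) _
     [seq ((fun _ => p.1), p.2) | p <- s2]).
  - by move=> _; apply: br_linr.
  - split=> [h' _|k u v Pu Pv h' lh']; first by rewrite (lin_map0 (br_linr _)) scaler0.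
    by rewrite br_linr Pu // Pv // scalerDr !scalerA mulrC.
  - move=> _ u Pu h' lh'; rewrite br_jacobi brH Pu // (lin_mapZ (br_linr _)).
    by rewrite (lin_map0 (br_linl _)) add0r.
  - by move=> _; apply: eig.
  - move=> p /List.in_map_iff [q [<- /S2 [qs qa]]] /=; split; last by move=> _; apply: sh.
    by move=> E; apply: qa; have := congr1 (fun u : unit -> C => u tt) E.
  - by rewrite big_map /= -SE -sy.
have [y [yb xy]] := fin (vbasis (fullv : {vspace H})).
exists y; split=> //; apply: rootsp_basis; first exact: fopp_lin.
by move=> i; apply: yb; apply: In_nth; rewrite size_tuple.
Qed.

(** * Opposite roots, and the form on the Cartan subalgebra and its dual *)

Lemma root_opp a : is_root a -> is_root (fopp a).
Proof.
case=> x [x0 xa]; have [y [ya xy]] := rootsp_pairing x0 xa.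
by exists y; split=> // y0; apply: xy; rewrite y0 (lin_map0 (B_linr _)).
Qed.

(** A vector pairing nontrivially with [iota h] may be taken of weight 0. It then centralizes the
    Cartan subalgebra, hence belongs to it. *)
Lemma B_nondegH h : (forall h', B (iota h) (iota h') = 0) -> h = 0.
Proof.
move=> hh; apply: NNPP => h0.
have ih0 : iota h <> 0.
  by rewrite -(lin_map0 iota_lin) => /iota_inj.
have ih : rootsp fzero (iota h) by move=> h'; rewrite brH scale0r.
have [y [y0 yh]] := rootsp_pairing ih0 ih.
have [h' yE] : exists h', y = iota h'.
  by apply: centralizer_H => h'; rewrite y0 /fopp oppr0 scale0r.
by apply: yh; rewrite yE.
Qed.

(** Since [tvec] is a choice, a representing vector must be exhibited. The Gram matrix of the form
    on a basis is invertible by nondegeneracy, and solving the linear system gives the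
    coordinates. *)
Lemma tvecP a : is_lin a -> forall h, B (iota (tvec a)) (iota h) = a h.
Proof.
move=> la; apply: (@epsilon_spec _ (inhabits 0) (fun t : H => forall h, B (iota t) (iota h) = a h)).
pose b := vbasis (fullv : {vspace H}).
pose M : 'M[C]_(\dim (fullv : {vspace H})) := \matrix_(i, j) B (iota b`_i) (iota b`_j).
pose vec (u : 'rV[C]_(\dim (fullv : {vspace H}))) := \sum_i u 0 i *: b`_i.
have vecM u (j : 'I_(\dim (fullv : {vspace H}))) : B (iota (vec u)) (iota b`_j) = (u *m M) 0 j.
  rewrite (lin_map_sum iota_lin) (lin_map_sum (B_linl _)) mxE.
  apply: eq_bigr => i _.
  by rewrite (lin_mapZ iota_lin) (lin_mapZ (B_linl _)) mxE.
have linB t : is_lin (fun h => B (iota t) (iota h)).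
  by move=> k u v; rewrite iota_lin B_linr.
have ext t : (forall j : 'I_(\dim (fullv : {vspace H})), B (iota t) (iota b`_j) = a b`_j) ->
    forall h, B (iota t) (iota h) = a h.
  move=> tj h; rewrite (lin_coord h la) (lin_coord h (linB t)).
  by apply: eq_bigr => i _; rewrite tj.
have Mfree : row_free M.
  apply: inj_row_free => u uM.
  have u0 : vec u = 0.
    apply: B_nondegH => h; rewrite (lin_coord h (linB _)) big1 // => i _.
    by rewrite vecM uM mxE mulr0.
  apply/rowP => i.
  rewrite mxE -(coord_sum_free (u 0) i (basis_free (vbasisP _))) -[X in coord _ _ X]/(vec u) u0.
  exact: linear0.
have Munit : M \in unitmx by rewrite -row_free_unit.
exists (vec (\row_j a b`_j *m invmx M)); apply: ext => j.
by rewrite vecM mulmxKV // mxE.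
Qed.

Lemma dform_sym a b : dform a b = dform b a. Proof. exact: B_sym. Qed.
Lemma dformE a b : is_lin a -> dform a b = a (tvec b).
Proof. by move=> la; rewrite /Defs.dform tvecP. Qed.

Definition faddc a (k : C) b : H -> C := fun h => a h + k * b h.
Lemma faddc_lin a k b : is_lin a -> is_lin b -> is_lin (faddc a k b).
Proof. by move=> la lb l u v; rewrite /faddc la lb; ring. Qed.
Lemma faddE a b : fadd a b = faddc a 1 b.
Proof. by fext; rewrite /faddc mul1r. Qed.
(** This shape lets the additivity lemmas of the form for [faddc] handle negatives as well. *)
Lemma foppE a : fopp a = faddc a (-2%:R) a.
Proof. by fext; rewrite /faddc; ring. Qed.

Lemma dform_addcl a k b c : is_lin a -> is_lin b ->
  dform (faddc a k b) c = dform a c + k * dform b c.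
Proof. by move=> la lb; rewrite !dformE //; apply: faddc_lin. Qed.
Lemma dform_addcr a k b c : is_lin a -> is_lin b ->
  dform c (faddc a k b) = dform c a + k * dform c b.
Proof. by move=> la lb; rewrite !(dform_sym c) dform_addcl. Qed.

(** The bracket has weight 0, so it lies in the Cartan subalgebra. Invariance gives both sides the
    same pairing with every [h'], and the form is nondegenerate there. *)
Lemma br_tvec a e f : is_lin a -> rootsp a e -> rootsp (fopp a) f ->
  br e f = B e f *: iota (tvec a).
Proof.
move=> la ea fa; have [h hE] : exists h, br e f = iota h.
  apply: centralizer_H => h; rewrite (rootsp_br ea fa) /fadd /fopp subrr scale0r //.
rewrite hE -(lin_mapZ iota_lin); congr iota; apply/eqP; rewrite -subr_eq0; apply/eqP.
apply: B_nondegH => h'; rewrite -scaleN1r addrC iota_lin B_linl -hE B_inv brC fa /fopp.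
rewrite (lin_mapN (B_linr _)) (lin_mapZ (B_linr _))
  (lin_mapZ iota_lin) (lin_mapZ (B_linl _)) tvecP //.
by rewrite /GRing.scale /=; ring.
Qed.

Lemma rootsp_iter a c x w n : rootsp a x -> rootsp c w ->
  rootsp (faddc c n%:R a) (iter n (br x) w).
Proof.
move=> xa wc; elim: n => [|n IH] /=.
  by have -> : faddc c 0%:R a = c by fext; rewrite /faddc mul0r addr0.
have -> : faddc c n.+1%:R a = fadd a (faddc c n%:R a).
  by fext; rewrite /faddc -natr1; ring.
exact: rootsp_br.
Qed.

(* [mu k] is the scalar by which [[x, y]] acts on [y^k w]. *)
Lemma ladder x y w (mu : nat -> C) : br x w = 0 ->
  (forall k, br (br x y) (iter k (br y) w) = mu k *: iter k (br y) w) ->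
  forall k, br x (iter k.+1 (br y) w) = (\sum_(i < k.+1) mu i) *: iter k (br y) w.
Proof.
move=> xw hw; elim=> [|k IH].
  by rewrite br_jacobi xw (lin_map0 (br_linr _)) addr0 big_ord1; apply: (hw 0%N).
rewrite [iter k.+2 _ _]/= br_jacobi -/(iter k.+1 (br y) w) hw IH (lin_mapZ (br_linr _)).
by rewrite -scalerDl addrC [in RHS]big_ord_recr.
Qed.

(** If the next vector of the string were 0, applying [x] to it would still return a nonzero
    multiple of the preceding vector. *)
Lemma ladder_neq0 x y w (mu : nat -> C) : br x w = 0 -> w <> 0 ->
  (forall k, br (br x y) (iter k (br y) w) = mu k *: iter k (br y) w) ->
  (forall k, \sum_(i < k.+1) mu i <> 0) -> forall k, iter k (br y) w <> 0.
Proof.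
move=> xw w0 hw mu0; elim=> [//|k IH] E; have := ladder xw hw k.
rewrite E (lin_map0 (br_linr _)) => /esym/eqP; rewrite scaler_eq0.
by move=> /orP[/eqP/mu0|/eqP/IH].
Qed.

(** * sl2-triples, root strings and reflections *)

Lemma root_x_lin a : root_x a -> is_lin a.
Proof. by case=> /root_lin. Qed.

Lemma rootx_opp a : root_x a -> root_x (fopp a).
Proof.
move=> [ra na]; have la := root_lin ra; split; first exact: root_opp.
rewrite foppE dform_addcl ?dform_addcr //.
set u := dform a a in na *.
by have -> : u + -2%:R * u + -2%:R * (u + -2%:R * u) = u by ring.
Qed.

Lemma cartan_opp c a : is_lin a -> cartan dform c (fopp a) = - cartan dform c a.
Proof.
move=> la; rewrite /cartan foppE !dform_addcl ?dform_addcr //.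
set u := dform c a; set v := dform a a.
have -> : v + -2%:R * v + -2%:R * (v + -2%:R * v) = v by ring.
have -> : u + -2%:R * u = - u by ring.
by rewrite mulrN mulNr.
Qed.

Lemma sl2_triple a e : root_x a -> rootsp a e -> e <> 0 -> exists f, rootsp (fopp a) f /\
  B e f <> 0 /\ forall c x, rootsp c x -> br (br e f) x = cartan dform c a *: x.
Proof.
move=> [ra na] ea e0; have la := root_lin ra.
have [f [fa ef]] := rootsp_pairing e0 ea.
have hB : B e ((2%:R / (dform a a * B e f)) *: f) = 2%:R / dform a a.
  by rewrite (lin_mapZ (B_linr _)) /GRing.scale /=; field; apply/andP; split; apply/eqP.
exists ((2%:R / (dform a a * B e f)) *: f); split; last split.
- by apply: (subspZ (rootsp_subsp _)).
- by rewrite hB; apply/eqP; rewrite mulf_neq0 ?pnatr_eq0 // invr_neq0 //; apply/eqP.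
move=> c x xc; rewrite (br_tvec la ea) ?hB; last by apply: (subspZ (rootsp_subsp _)).
rewrite (lin_mapZ (br_linl _)) xc scalerA.
case: (classic (x = 0)) => [->|x0]; first by rewrite !scaler0.
by rewrite /cartan (dformE _ (rootsp_linear x0 xc)) mulrAC.
Qed.

Lemma first_zero x w : w <> 0 -> (exists n, iter n (br x) w = 0) ->
  exists p, iter p (br x) w <> 0 /\ br x (iter p (br x) w) = 0.
Proof.
move=> w0 [n]; elim: n => [//|n IH] E.
by case: (classic (iter n (br x) w = 0)) => [/IH //|nz]; exists n.
Qed.

Lemma sum_arith (l : C) k : \sum_(i < k.+1) (l - 2%:R * i%:R) = k.+1%:R * (l - k%:R).
Proof.
elim: k => [|k IH]; first by rewrite big_ord1 /=; ring.
by rewrite big_ord_recr /= IH -[k.+2%:R]natr1 -![k.+1%:R]natr1; ring.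
Qed.

Lemma cartan_addc c k b a : is_lin c -> is_lin b ->
  cartan dform (faddc c k b) a = cartan dform c a + k * cartan dform b a.
Proof. by move=> lc lb; rewrite /cartan dform_addcl //; ring. Qed.

Lemma cartan_self a : root_x a -> cartan dform a a = 2%:R.
Proof. by move=> [_ /eqP na]; rewrite /cartan; field. Qed.

(** Local nilpotency allows climbing [p] steps to a vector killed by [e], then descending [q] steps
    to the last nonzero vector. There the ladder scalar (q + 1)(l - q), with l the top weight, must
    vanish, so l = q, where l is the Cartan number of [c] plus 2p. *)
Lemma root_string a c : root_x a -> is_root c -> exists p q : nat,
  cartan dform c a = q%:R - 2%:R * p%:R /\
  forall k, (k <= q)%N -> is_root (faddc c (p%:R - k%:R) a).
Proof.
move=> rxa rc; have [ra _] := rxa; have la := root_lin ra; have lc := root_lin rc.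
case: ra => e [e0 ea]; have [f [fa [_ hact]]] := sl2_triple rxa ea e0.
case: rc => v [v0 vc].
have [p [w0 ew]] := first_zero v0 (ad_nilp v rxa ea).
set w := iter p (br e) v in w0 ew.
have wc : rootsp (faddc c p%:R a) w by apply: rootsp_iter.
have [q [u0 fu]] := first_zero w0 (ad_nilp w (rootx_opp rxa) fa).
have wk k : rootsp (faddc c (p%:R - k%:R) a) (iter k (br f) w).
  have -> : faddc c (p%:R - k%:R) a = faddc (faddc c p%:R a) k%:R (fopp a).
    by fext; rewrite /faddc; ring.
  exact: rootsp_iter.
have mu k : br (br e f) (iter k (br f) w) =
    (cartan dform c a + 2%:R * p%:R - 2%:R * k%:R) *: iter k (br f) w.
  rewrite (hact _ _ (wk k)) cartan_addc // cartan_self //; congr (_ *: _); ring.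
have := ladder ew mu q.
rewrite [iter q.+1 _ _]/= fu (lin_map0 (br_linr _)) sum_arith => /esym/eqP.
rewrite scaler_eq0 mulf_eq0 pnatr_eq0 /= => /orP[|/eqP //]; rewrite subr_eq0 => /eqP E.
exists p, q; split; first by rewrite -E; ring.
move=> k kq; exists (iter k (br f) w); split=> // k0; apply: u0.
by rewrite -(subnK kq) iterD k0; elim: (q - k)%N => //= n ->; rewrite (lin_map0 (br_linr _)).
Qed.

Lemma cartan_int a c : root_x a -> is_root c -> exists n : int, cartan dform c a = n%:~R.
Proof.
move=> rxa /(root_string rxa) [p [q [E _]]]; exists (Posz q - 2 * Posz p).
by rewrite E rmorphB rmorphM.
Qed.

Lemma root_reflect a c : root_x a -> is_root c -> is_root (faddc c (- cartan dform c a) a).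
Proof.
move=> rxa rc; have [p [q [E st]]] := root_string rxa rc.
case: (leqP p q) => pq.
  have -> : - cartan dform c a = p%:R - (q - p)%:R by rewrite E natrB //; ring.
  by apply: st; apply: leq_subr.
(* If q < p, the Cartan number q - 2p is negative. The string is then taken along [- a], where q' <
   p' would make the opposite number negative too. *)
have la := root_x_lin rxa.
have [p' [q' [E' st']]] := root_string (rootx_opp rxa) rc.
rewrite cartan_opp // in E'.
have pq' : (p' <= q')%N.
  rewrite leqNgt; apply/negP => pq'.
  have : (q%:R - 2%:R * p%:R) + (q'%:R - 2%:R * p'%:R) = 0 :> C by rewrite -E -E' addrN.
  have -> : (q%:R - 2%:R * p%:R) + (q'%:R - 2%:R * p'%:R) =
     (Posz q - 2 * Posz p + (Posz q' - 2 * Posz p'))%:~R :> C.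
    by rewrite [in RHS]rmorphD [in RHS]rmorphB [in RHS]rmorphB !rmorphM.
  by move/eqP; rewrite intr_eq0 => /eqP; lia.
have -> : faddc c (- cartan dform c a) a = faddc c (p'%:R - (q' - p')%:R) (fopp a).
  by rewrite E' natrB //; fext; rewrite /faddc; ring.
by apply: st'; apply: leq_subr.
Qed.

(** A vector of weight [a] independent of [x] can be corrected to some [w] orthogonal to [f], hence
    killed by ad [f]. As a lowest weight vector of positive weight 2, it generates an infinite
    string under ad [x], against local nilpotency. *)
Lemma root_x_dim1 a x y : root_x a -> rootsp a x -> rootsp a y -> x <> 0 ->
  exists k : C, y = k *: x.
Proof.
move=> rxa xa ya x0; have [f [fa [/eqP Bxf hact]]] := sl2_triple rxa xa x0.
exists (B y f / B x f); apply: NNPP => ne.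
pose w := y - (B y f / B x f) *: x.
have w0 : w <> 0 by move/eqP; rewrite subr_eq0 => /eqP.
have wa : rootsp a w.
  rewrite /w addrC -scaleNr; exact: (proj2 (rootsp_subsp a)).
have Bwf : B w f = 0.
  by rewrite /w addrC -scaleNr B_linl /GRing.scale /=; field.
have fw : br f w = 0.
  by rewrite brC (br_tvec (root_x_lin rxa) wa fa) Bwf scale0r oppr0.
have [n] := ad_nilp w rxa xa.
have wk k : rootsp (faddc a k%:R a) (iter k (br x) w) by apply: rootsp_iter.
(* The ladder is used with the two sides of the triple exchanged: [f, x] acts on x^k w by - (2 +
   2k). *)
apply: (@ladder_neq0 f x w (fun k => - 2%:R - 2%:R * k%:R) fw w0) => k.
  rewrite (brC f x) (lin_mapN (br_linl _)) (hact _ _ (wk k)) -scaleNr; congr (_ *: _).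
  by rewrite cartan_addc ?cartan_self //; [ring | exact: root_x_lin | exact: root_x_lin].
have -> : \sum_(i < k.+1) (-2%:R - 2%:R * i%:R) = - (k.+1 * k.+2)%:R :> C.
  by rewrite sum_arith natrM -[k.+2%:R]natr1; ring.
by apply/eqP; rewrite oppr_eq0 pnatr_eq0.
Qed.

(* In the Heisenberg algebra spanned by [x] in [G_d], [y] in [G_(-d)] and [t_d], the scalar
   [dform d a] by which [t_d] acts on [G_a] must vanish if the [d]-string through [a] stops
   in both directions. *)
Lemma isotropic_string d a : is_root d -> dform d d = 0 -> is_root a -> dform d a <> 0 ->
  (forall n : nat, is_root (faddc a n%:R d)) \/
  exists p : nat, forall k : nat, is_root (faddc a (p%:R - k%:R) d).
Proof.
move=> rd d0 ra da; have ld := root_lin rd; have la := root_lin ra.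
case: (rd) => x [x0 xd]; have [y [yd xy]] := rootsp_pairing x0 xd.
case: (ra) => v [v0 va].
case: (classic (exists n, iter n (br x) v = 0)) => [nil|inf]; last first.
  left=> n; exists (iter n (br x) v); split; last exact: rootsp_iter.
  by move=> E; apply: inf; exists n.
right; have [p [w0 xw]] := first_zero v0 nil; exists p => k.
set w := iter p (br x) v in w0 xw.
have wk j : rootsp (faddc a (p%:R - j%:R) d) (iter j (br y) w).
  have -> : faddc a (p%:R - j%:R) d = faddc (faddc a p%:R d) j%:R (fopp d).
    by fext; rewrite /faddc; ring.
  by apply: rootsp_iter => //; apply: rootsp_iter.
exists (iter k (br y) w); split=> //.
apply: (@ladder_neq0 x y w (fun _ => B x y * dform d a) xw w0) => j.
  rewrite (br_tvec ld xd yd) (lin_mapZ (br_linl _)) wk scalerA; congr (_ * _ *: _).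
  rewrite -dformE; last exact: faddc_lin.
  by rewrite dform_addcl // d0 mulr0 addr0 dform_sym.
rewrite sumr_const card_ord; apply/eqP; rewrite -mulr_natr !mulf_neq0 //; try exact/eqP.
by rewrite pnatr_eq0.
Qed.

(** If n, the Cartan integer of [d] with respect to [a], were nonzero, one of the roots a + 3d, a -
    3d would exist by the infinite string, and the Cartan number of [a] with respect to it would
    fail to be an integer. *)
Lemma root_0_orth d a : root_0 d -> root_x a -> dform d a = 0.
Proof.
move=> [rd d0] rxa; have [ra na] := rxa; apply: NNPP => da.
have ld := root_lin rd; have la := root_lin ra.
have [n nE] := cartan_int rxa rd.
have aa : dform a a != 0 by apply/eqP.
have n0 : n <> 0.
  move=> n0; move: nE; rewrite n0 /cartan => /eqP.
  rewrite !mulf_eq0 invr_eq0 pnatr_eq0 /= => /orP[|/eqP //].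
  by move/eqP.
have daE : dform d a = n%:~R * dform a a / 2%:R by rewrite -nE /cartan; field.
(* The Cartan number of a with respect to a + md is (2 + mn) / (1 + mn) = 1 + 1 / (1 + mn).
   Integrality forces mn = 0 or mn = -2, which [m] = 3 or -3 excludes for nonzero n. *)
have key (m : int) : m = 3 \/ m = - 3 -> ~ is_root (faddc a m%:~R d).
  move=> m3 rm.
  have norm_m : dform (faddc a m%:~R d) (faddc a m%:~R d) = (1 + m * n)%:~R * dform a a.
    rewrite dform_addcl // !dform_addcr // d0 (dform_sym a d) daE rmorphD rmorphM /=.
    by field.
  have form_m : dform a (faddc a m%:~R d) = (2 + m * n)%:~R * dform a a / 2%:R.
    rewrite dform_addcr // (dform_sym a d) daE rmorphD rmorphM /=.
    by field.
  have N0 : (1 + m * n) != 0 by apply/eqP; lia.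
  have [|k kE] := @cartan_int (faddc a m%:~R d) a _ ra.
    by split=> //; apply/eqP; rewrite norm_m mulf_neq0 // intr_eq0.
  move: kE; rewrite /cartan norm_m form_m => kE.
  have : (k * (1 + m * n) - (2 + m * n))%:~R = 0 :> C.
    have NC : 1 + m%:~R * n%:~R != 0 :> C by move: N0; rewrite -(intr_eq0 C) rmorphD rmorphM.
    rewrite rmorphB rmorphM /= -kE; field.
    by rewrite aa NC.
  move/eqP; rewrite intr_eq0 => /eqP.
  case: m3 => -> E.
  - have /int_mul_eq1 : (k - 1) * (1 + 3 * n) = 1.
      by have -> : (k - 1) * (1 + 3 * n) = k * (1 + 3 * n) - (2 + 3 * n) + 1; [ring | rewrite E].
    lia.
  - have /int_mul_eq1 : (k - 1) * (1 + - 3 * n) = 1.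
      by have -> : (k - 1) * (1 + - 3 * n) = k * (1 + - 3 * n) - (2 + - 3 * n) + 1;
        [ring | rewrite E].
    lia.
case: (isotropic_string rd d0 ra da) => [all|[p all]].
- by apply: (key 3); [left | apply: (all 3%N)].
- apply: (key (- 3)); first by right.
  have := all (p + 3)%N; rewrite natrD opprD addNKr; exact.
Qed.

(** * The core *)

Notation core := (core br B iota).
Notation core_center := (core_center br B iota).
Notation Lam_t := (Lam_t br B iota).
Notation root_t := (root_t br B iota).
Notation root_t0 := (root_t0 br B iota).

Lemma core_gen a x : root_x a -> rootsp a x -> core x.
Proof. by move=> ra xa S _; apply; [exact: ra|]. Qed.

Lemma core_subsp : subsp core.
Proof.
split=> [S [Ss _] _|k x y cx cy S Sa Sg]; first exact: subsp0.
by case: (Sa) => -[_ Sl] _; apply: Sl; [apply: cx|apply: cy].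
Qed.

Lemma core_br x y : core x -> core y -> core (br x y).
Proof. by move=> cx cy S Sa Sg; apply: (proj2 Sa); [apply: cx|apply: cy]. Qed.

Lemma root_x_shift d a : root_0 d -> root_x a -> dform (fadd d a) (fadd d a) = dform a a.
Proof.
move=> rd ra; have od := root_0_orth rd ra; have [rd1 d0] := rd.
have ld := root_lin rd1; have la := root_x_lin ra.
by rewrite faddE dform_addcl // !dform_addcr // (dform_sym a) od d0; ring.
Qed.

(** Homogeneous vectors that turn out to span the core. In the second clause the weight is required
    to be an isotropic root, so every atom, even a zero one, has its weight in R_t. *)
Definition atom a x := (root_x a /\ rootsp a x) \/
  exists b c y z, root_x b /\ root_x c /\ rootsp b y /\ rootsp c z /\
    root_0 a /\ a = fadd b c /\ x = br y z.

Lemma atom_rootsp a x : atom a x -> rootsp a x.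
Proof. by case=> [[] //|[b [c [y [z [_ [_ [yb [zc [_ [-> ->]]]]]]]]]]]; apply: rootsp_br. Qed.

Lemma atom_core a x : atom a x -> core x.
Proof.
case=> [[] /core_gen //|[b [c [y [z [rb [rc [yb [zc [_ [_ ->]]]]]]]]]]]; first exact.
by apply: core_br; [apply: core_gen rb yb|apply: core_gen rc zc].
Qed.

Lemma atom_root_t a x : atom a x -> root_t a.
Proof.
case=> [[]|[b [c [y [z [rb [rc [_ [_ [ra [aE _]]]]]]]]]]]; first by left.
(* For a = b + c, the root - c witnesses membership in R_t^0, because a - c = b is a root. *)
right; split=> //; exists (fopp c); split; first exact: rootx_opp.
have -> : fadd a (fopp c) = b by rewrite aE; fext; ring.
by case: rb.
Qed.

Lemma atomZ k a x : atom a x -> atom a (k *: x).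
Proof.
case=> [[ra xa]|[b [c [y [z [rb [rc [yb [zc [ra [aE xE]]]]]]]]]]]; [left|right].
  by split=> //; apply: (subspZ (rootsp_subsp _)).
exists b, c, (k *: y), z; do !split=> //; first by apply: (subspZ (rootsp_subsp _)).
by rewrite xE (lin_mapZ (br_linl _)).
Qed.

Definition atom_span x := exists s : seq ((H -> C) * G),
  (forall p, List.In p s -> atom p.1 p.2) /\ x = \sum_(p <- s) p.2.

Lemma atom_span_gen a x : atom a x -> atom_span x.
Proof. by move=> ax; exists [:: (a, x)]; rewrite big_seq1; split=> // p [<- //|]. Qed.

Lemma atom_span0 : atom_span 0.
Proof. by exists [::]; rewrite big_nil. Qed.

Lemma atom_span_subsp : subsp atom_span.
Proof.
split=> [|k x y [s [sa ->]] [t [ta ->]]]; first exact: atom_span0.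
exists ([seq (p.1, k *: p.2) | p <- s] ++ t); split.
  move=> p /(@List.in_app_or _ _ _ _) [/List.in_map_iff [q [<- qs]]|/ta //].
  by move=> /=; apply: atomZ; apply: (sa q).
by rewrite big_cat big_map /= scaler_sumr.
Qed.

Lemma atom_span_lin (f : G -> G) x : lin_map f ->
  (forall a y, atom a y -> atom_span (f y)) -> atom_span x -> atom_span (f x).
Proof.
move=> lf fa [s [sa ->]]; rewrite (lin_map_sum lf).
by apply: (subsp_sum atom_span_subsp) => p ps; apply: fa (sa p ps).
Qed.

(** The bracket of two nonisotropic root vectors is an atom of one of the two kinds, or 0. Against
    an atom of isotropic weight, the total weight keeps the norm of [a], so a nonzero result is
    again a nonisotropic root vector. *)
Lemma atom_span_ad a y x : root_x a -> rootsp a y -> atom_span x -> atom_span (br y x).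
Proof.
move=> ra ya; apply: atom_span_lin; first exact: br_linr.
move=> b z bz; case: (classic (br y z = 0)) => [->|yz0]; first exact: atom_span0.
have rab : is_root (fadd a b).
  by exists (br y z); split=> //; apply: rootsp_br => //; apply: atom_rootsp.
case: bz => [[rb zb]|[c1 [c2 [z1 [z2 [r1 [r2 [z1r [z2r [r0b [bE zE]]]]]]]]]]].
- case: (classic (dform (fadd a b) (fadd a b) = 0)) => n0.
    apply: (@atom_span_gen (fadd a b)); right.
    by exists a, b, y, z; do !split=> //.
  by apply: (@atom_span_gen (fadd a b)); left; split; [split | apply: rootsp_br].
- apply: (@atom_span_gen (fadd a b)); left; split; last first.
    by apply: rootsp_br => //; rewrite zE bE; apply: rootsp_br.
  split=> //; have -> : fadd a b = fadd b a by fext; ring.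
  by rewrite root_x_shift //; case: ra.
Qed.

Lemma atom_span_br x y : atom_span x -> atom_span y -> atom_span (br x y).
Proof.
move=> sx sy; move: sx; apply: (@atom_span_lin (br^~ y)); first exact: br_linl.
move=> a z [[ra za]|[b [c [u [v [rb [rc [ub [vc [_ [_ ->]]]]]]]]]]].
  exact: atom_span_ad ra za sy.
(* By Jacobi, ad [u, v] is the commutator of ad u and ad v, which reduces bracket atoms to root
   vectors. *)
have -> : br (br u v) y = (-1) *: br v (br u y) + br u (br v y).
  by rewrite (br_jacobi u) scaleN1r addrC addrK.
apply: (proj2 atom_span_subsp).
  exact: atom_span_ad rc vc (atom_span_ad rb ub sy).
exact: atom_span_ad rb ub (atom_span_ad rc vc sy).
Qed.

Lemma core_atom_span x : core x -> atom_span x.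
Proof.
apply; first by split; [exact: atom_span_subsp | exact: atom_span_br].
by move=> a y ra ya; apply: (@atom_span_gen a); left.
Qed.

(** In a decomposition of [x] into atoms only those of weight [g] matter: the others contribute 0,
    by [weight_component] applied to the zero subspace. *)
Lemma core_component g x : core x -> rootsp g x ->
  exists s : seq G, (forall y, List.In y s -> atom g y) /\ x = \sum_(y <- s) y.
Proof.
move=> /core_atom_span [s [sa xE]] xg.
have [s1 [s2 [S1 [S2 SE]]]] := sum_partition g s.
exists (map snd s1); split.
  by move=> y /List.in_map_iff [p [<- /S1 [ps <-]]]; apply: sa.
rewrite big_map; apply/eqP; rewrite -subr_eq0; apply/eqP.
have x1 : rootsp g (x - \sum_(p <- s1) p.2).
  rewrite addrC -scaleN1r; apply: (proj2 (rootsp_subsp g)) => //.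
  apply: (subsp_sum (rootsp_subsp g)) => p /S1 [ps <-].
  by apply: atom_rootsp; apply: sa.
apply: (@weight_component H G (fun h => br (iota h)) (fun u => u = 0) g _
   [seq (p.1, - p.2) | p <- s2]) => //.
- by move=> h; apply: br_linr.
- by split=> // k u v -> ->; rewrite scaler0 addr0.
- by move=> h u ->; rewrite (lin_map0 (br_linr _)).
- move=> p /List.in_map_iff [q [<- /S2 [qs qg]]] /=; split=> // h.
  by rewrite (lin_mapN (br_linr _)) (atom_rootsp (sa q qs)) scalerN.
- by rewrite big_map /= sumrN xE SE -addrA -opprD subrr.
Qed.

Lemma core_weight g x : core x -> rootsp g x -> x <> 0 -> root_t g.
Proof.
move=> cx xg x0; have [[|y s] [sa xE]] := core_component cx xg.
  by case: x0; rewrite xE big_nil.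
by apply: (@atom_root_t g y); apply: sa; left.
Qed.

(** * Orthogonality of the isotropic lattice, and the centre of the core *)

Lemma root_0_lin d : root_0 d -> is_lin d.
Proof. by case=> /root_lin. Qed.

Lemma lam_lin_orth l : Lam_t l -> is_lin l /\ forall a, root_x a -> dform l a = 0.
Proof.
elim/zspan_ind => [|g k u [lg og] [r0u _]].
  have l0 : is_lin (@fzero H) by move=> k u v; rewrite /fzero mulr0 addr0.
  by split=> // a _; rewrite dformE.
have lu := root_0_lin r0u.
split; first exact: faddc_lin.
by move=> a ra; rewrite (dform_addcl _ _ lg lu) og // root_0_orth // mulr0 addr0.
Qed.

Lemma lam_lin l : Lam_t l -> is_lin l.
Proof. by case/lam_lin_orth. Qed.
Lemma lam_orth l a : Lam_t l -> root_x a -> dform l a = 0.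
Proof. by case/lam_lin_orth => _; apply. Qed.
Lemma lam_not_root_x l : Lam_t l -> ~ root_x l.
Proof. by move=> ll rl; case: (rl) => _; apply; apply: lam_orth. Qed.

(** This is what makes the centre graded. The annihilator of the nonisotropic root vectors stands in
    for the centre, since its stability under ad [h] needs no membership in the core. *)
Lemma adH_centralizer_stable h x :
  (forall a y, root_x a -> rootsp a y -> br x y = 0) ->
  forall a y, root_x a -> rootsp a y -> br (br (iota h) x) y = 0.
Proof.
move=> xc a y ra ya; have := br_jacobi (iota h) x y.
rewrite (xc a y) // (lin_map0 (br_linr _)) ya (lin_mapZ (br_linr _)) (xc a y) //.
by rewrite scaler0 addr0.
Qed.

(** By Jacobi the elements commuting with [x] form a subalgebra, so it is enough to test the
    generators of the core. *)
Lemma core_centerP x : core x ->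
  (core_center x <-> forall a y, root_x a -> rootsp a y -> br x y = 0).
Proof.
move=> cx; split=> [[_ xc] a y ra ya|xc]; first by apply: xc; apply: core_gen ra ya.
split=> // y cy; apply: (cy (fun u => br x u = 0)); last exact: xc.
split; first split; first by rewrite (lin_map0 (br_linr _)).
- by move=> k u v xu xv; rewrite br_linr xu xv scaler0 addr0.
- by move=> u v xu xv; rewrite br_jacobi xu xv (lin_map0 (br_linl _)) (lin_map0 (br_linr _)) addr0.
Qed.

(** The partner [f] in an sl2-triple also lies in the core, and [x, f] acts on [x] by 2, so it
    cannot vanish. *)
Lemma root_vector_not_central a x : root_x a -> rootsp a x -> x <> 0 -> ~ core_center x.
Proof.
move=> ra xa x0 [_ xc]; have [f [fa [_ hact]]] := sl2_triple ra xa x0.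
have cf : core f by apply: core_gen fa; apply: rootx_opp.
have := hact _ _ xa; rewrite (xc _ cf) (lin_map0 (br_linl _)) cartan_self // => /esym/eqP.
by rewrite scaler_eq0 pnatr_eq0 /= => /eqP.
Qed.

Lemma fscale_lin k a : is_lin a -> is_lin (fscale k a).
Proof. by move=> la l u v; rewrite /fscale la; ring. Qed.
Lemma dform_scalel k a b : is_lin a -> dform (fscale k a) b = k * dform a b.
Proof. by move=> la; rewrite !dformE //; apply: fscale_lin. Qed.
Lemma dform_scaler k a b : is_lin a -> dform b (fscale k a) = k * dform b a.
Proof. by move=> la; rewrite !(dform_sym b) dform_scalel. Qed.

(** * The finite root system *)

Variable Rd : seq (H -> C).
Hypothesis hRd : Rdot_ok br B iota Rd.
Notation Qd := (zspan (fun a => List.In a Rd)).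

Lemma Rd_lin a : List.In a Rd -> is_lin a.
Proof. by case: hRd => [[ll _] _]; apply: ll. Qed.

Lemma Rd_zero : List.In fzero Rd.
Proof. by case: hRd => [[_ []]]. Qed.

Lemma Rd_cartan_int a b : List.In a Rd -> List.In b Rd -> a <> fzero ->
  exists z : int, cartan dform b a = z%:~R.
Proof. by case: hRd => [[_ [_ [c [_ [_ [_ ci]]]]]] _] Ra Rb a0; case: (ci a b Ra Rb a0). Qed.

Lemma Rd_anisotropic a : List.In a Rd -> a <> fzero -> dform a a <> 0.
Proof.
case: hRd => [[_ [_ [c [_ [_ [pd _]]]]]] _] Ra a0 aa; apply: a0.
have := pd [:: (a, 1)]; case; first by move=> p [<-|//]; split=> //; apply: rpred1.
have -> : (fun h => \sum_(p <- [:: (a, 1 : C)]) p.2 * p.1 h) = a.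
  by apply: functional_extensionality => h; rewrite big_seq1 mul1r.
by rewrite aa mulr0 => _; apply.
Qed.

Lemma root_t_decomp a : root_t a -> exists b l, List.In b Rd /\ Lam_t l /\ a = fadd b l.
Proof. by case: hRd => _ [_ [dec _]]; apply: dec. Qed.

Lemma Qd_lam_disjoint g : Qd g -> Lam_t g -> g = fzero.
Proof.
case: hRd => _ [_ [_ [_ [_ dis]]]] Qf Lf; apply: dis => //.
by apply: zspan_sub Lf => u [r0u _]; apply: zspan_gen.
Qed.

Lemma Qd_lam_inj a b l m : Qd a -> Qd b -> Lam_t l -> Lam_t m ->
  fadd a l = fadd b m -> a = b /\ l = m.
Proof.
move=> Qa Qb Ll Lm E.
have E1 : fsub a b = fsub m l.
  apply: functional_extensionality => h.
  have := congr1 (fun u => u h) E; rewrite /fadd /fsub => /eqP.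
  by rewrite eq_sym -subr_eq => /eqP <-; ring.
have z : fsub a b = fzero by apply: Qd_lam_disjoint; [exact: zspanB|rewrite E1; exact: zspanB].
have ab : a = b.
  apply: functional_extensionality => h; have := congr1 (fun u => u h) z.
  by rewrite /fsub /fzero => /eqP; rewrite subr_eq0 => /eqP.
split=> //; apply: functional_extensionality => h.
have := congr1 (fun u => u h) E; rewrite ab /fadd.
exact: addrI.
Qed.

(* If [a / 2] is a root then [a / 4] is not, because its Cartan integer with [a] would be 1/2. *)
Lemma Rd_root_multiple a : List.In a Rd -> a <> fzero ->
  exists k : C, k <> 0 /\ List.In (fscale k a) Rd /\ root_x (fscale k a).
Proof.
move=> Ra a0; have la := Rd_lin Ra; have aa := Rd_anisotropic Ra a0.
have ind b : List.In b Rd -> b <> fzero -> ~ List.In (fhalf b) Rd -> root_x b.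
  by case: hRd => _ [_ [_ [ir _]]] Rb b0 nb; case: (ir b Rb nb).
have halfE b : fhalf b = fscale (2%:R^-1) b by fext; rewrite /fscale mulrC.
case: (classic (List.In (fhalf a) Rd)) => [Rh|nRh]; last first.
  exists 1; have -> : fscale 1 a = a by fext; rewrite /fscale mul1r.
  by split; [apply/eqP; exact: oner_neq0 | split=> //; apply: ind].
have n2 : 2%:R != 0 :> C by rewrite pnatr_eq0.
exists (2%:R^-1); split; first by apply/eqP; rewrite invr_eq0.
rewrite -halfE; split=> //; apply: ind => //.
  move=> h0; apply: a0; apply: functional_extensionality => h.
  have := congr1 (fun u => u h) h0; rewrite /fhalf /fzero => /eqP.
  by rewrite mulf_eq0 invr_eq0 (negbTE n2) orbF => /eqP.
move=> Rq; have [z] := Rd_cartan_int Ra Rq a0.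
rewrite /cartan !halfE !dform_scalel //; last exact: fscale_lin.
have -> : 2%:R * (2%:R^-1 * (2%:R^-1 * dform a a)) / dform a a = 2%:R^-1 by field; apply/eqP.
move=> E; have : (2 * z)%:~R = 1 :> C by rewrite rmorphM /= -E; field.
move/eqP; rewrite (_ : 1 = 1%:~R) // eqr_int => /eqP; lia.
Qed.

(** An element of [Rd] may fail to be a root, but orthogonality passes to it from its multiple that
    is one. *)
Lemma lam_orth_Rd l a : Lam_t l -> List.In a Rd -> dform l a = 0.
Proof.
move=> Ll Ra; have la := Rd_lin Ra; case: (classic (a = fzero)) => [->|a0].
  by rewrite dform_sym dformE //; apply: (Rd_lin Rd_zero).
have [k [/eqP k0 [_ rk]]] := Rd_root_multiple Ra a0.
have := lam_orth Ll rk; rewrite dform_scaler // => /eqP.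
by rewrite mulf_eq0 (negbTE k0) => /eqP.
Qed.

Lemma root_t_in_Rd a l : Qd a -> Lam_t l -> root_t (fadd a l) -> List.In a Rd.
Proof.
move=> Qa Ll /root_t_decomp [b [m [Rb [Lm E]]]].
by have [->] := Qd_lam_inj Qa (zspan_gen Rb) Ll Lm E.
Qed.

(** Were a + l in R_t^0, it would have the two decompositions a + l and 0 + (a + l), forcing a =
    0. *)
Lemma root_t_root_x a l : Qd a -> a <> fzero -> Lam_t l -> root_t (fadd a l) ->
  root_x (fadd a l).
Proof.
move=> Qa a0 Ll [//|r0]; case: a0.
have E : fadd a l = fadd fzero (fadd a l) by fext; rewrite add0r.
by have [] := Qd_lam_inj Qa (zspan0 _) Ll (zspan_gen r0) E.
Qed.

Lemma root_x_decomp a : root_x a ->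
  exists b l, List.In b Rd /\ b <> fzero /\ Lam_t l /\ a = fadd b l.
Proof.
move=> ra; have [b [l [Rb [Ll aE]]]] := root_t_decomp (or_introl ra).
exists b, l; do !split=> //; move=> b0; apply: (@lam_not_root_x l) => //.
by move: ra; rewrite aE b0; have -> : fadd fzero l = l by fext; rewrite add0r.
Qed.

(** The isotropic parts drop out: [m] is orthogonal to the root a + l, and [l] to [b]. Hence the
    sl2-triples act on the grading through the Cartan integers of [Rd]. *)
Lemma dform_shift a b l m : List.In a Rd -> List.In b Rd -> Lam_t l -> Lam_t m ->
  root_x (fadd a l) -> dform (fadd b m) (fadd a l) = dform b a.
Proof.
move=> Ra Rb Ll Lm rx; have lb := Rd_lin Rb; have la := Rd_lin Ra.
rewrite {1}faddE dform_addcl //; last exact: lam_lin.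
rewrite (lam_orth Lm rx) faddE dform_addcr //; last exact: lam_lin.
by rewrite (dform_sym b l) (lam_orth_Rd Ll Rb); ring.
Qed.

Lemma cartan_shift a b l m : List.In a Rd -> List.In b Rd -> Lam_t l -> Lam_t m ->
  root_x (fadd a l) -> cartan dform (fadd b m) (fadd a l) = cartan dform b a.
Proof. by move=> *; rewrite /cartan !dform_shift. Qed.

(** * Freeness of the isotropic lattice *)

(** The set S_b, defined for every [b] so that the sets of different elements of [Rd] can be
    compared. *)
Definition root_shift b l := Lam_t l /\ is_root (fadd b l).

(** An isotropic b + l would be orthogonal to the nonisotropic root k b, yet its pairing with it is
    k (b, b). *)
Lemma lam_root_x b l : List.In b Rd -> b <> fzero -> Lam_t l -> is_root (fadd b l) ->
  root_x (fadd b l).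
Proof.
move=> Rb b0 Ll rb; split=> //; have lb := Rd_lin Rb; have ll := lam_lin Ll.
have [k [k0 [Rk rk]]] := Rd_root_multiple Rb b0.
move=> n0; have := root_0_orth (conj rb n0) rk.
rewrite dform_scaler // faddE dform_addcl // (lam_orth_Rd Ll Rb) mulr0 addr0 => /eqP.
rewrite mulf_eq0 => /orP[/eqP //|/eqP]; exact: Rd_anisotropic.
Qed.

(* Reflecting [c + m] in [b + l] and then in the multiple of [b] that is a root brings
   the [Rd]-part back to [c]. *)
Lemma root_shift_reflect b c l m (n : int) : List.In b Rd -> b <> fzero -> List.In c Rd ->
  cartan dform c b = n%:~R -> root_shift b l -> root_shift c m ->
  root_shift c (faddz m (- n) l).
Proof.
move=> Rb b0 Rc cb [Ll rl] [Lm rm]; split; first exact: zspan_add.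
have rxl := lam_root_x Rb b0 Ll rl.
have lb := Rd_lin Rb; have lc := Rd_lin Rc; have ll := lam_lin Ll; have lm := lam_lin Lm.
have := root_reflect rxl rm; rewrite (cartan_shift Rb Rc Ll Lm rxl) cb.
set x := faddc _ _ _ => rx; have lx := root_lin rx.
have [k [/eqP k0 [Rk rk]]] := Rd_root_multiple Rb b0.
have := root_reflect rk rx.
(* Here (x, b) = (c, b) - n (b, b) = - n (b, b) / 2. The second reflection therefore adds (n / k) k
   b = n b, cancelling the - n b of the first. *)
have -> : cartan dform x (fscale k b) = - n%:~R / k.
  have /eqP bb := Rd_anisotropic Rb b0.
  have xb : dform x b = dform c b - n%:~R * dform b b.
    rewrite /x !faddE !dform_addcl //; try exact: faddc_lin.
    rewrite (lam_orth_Rd Ll Rb) (lam_orth_Rd Lm Rb); ring.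
  rewrite -cb /cartan dform_scaler // dform_scaler // dform_scalel // xb -cb /cartan.
  by field; rewrite k0 bb.
congr is_root; apply: functional_extensionality => h.
by rewrite /x /faddc /faddz /fscale /fadd rmorphN /=; field.
Qed.

Lemma root_shift0 b : root_x b -> root_shift b fzero.
Proof.
move=> [rb _]; split; first exact: zspan0.
by have -> : fadd b fzero = b by fext; rewrite addr0.
Qed.

(** One-sided despite the name: one multiplier must serve all of [X], while nothing is asked of
    [Y]. *)
Definition commensurable (X Y : (H -> C) -> Prop) :=
  exists N : int, N <> 0 /\ forall l, X l -> zspan Y (fscale N%:~R l).

(** Reflecting the unshifted root [c] in b + l shows that - n l lies in S_c, where n is the Cartan
    integer of [c] with respect to [b], nonzero because they are not orthogonal. *)
Lemma root_shift_commensurable b c X : List.In b Rd -> b <> fzero -> List.In c Rd -> root_x c ->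
  dform c b <> 0 -> commensurable (root_shift c) X -> commensurable (root_shift b) X.
Proof.
move=> Rb b0 Rc rc /eqP cb [N [N0 NX]].
have /eqP bb := Rd_anisotropic Rb b0.
have [n nE] := Rd_cartan_int Rb Rc b0.
have n0 : n <> 0.
  move=> n0; move: nE; rewrite n0 /cartan => /eqP.
  by rewrite !mulf_eq0 invr_eq0 pnatr_eq0 (negbTE cb) (negbTE bb).
exists (N * - n); split; first by apply/eqP; rewrite mulf_neq0 ?oppr_eq0; apply/eqP.
move=> l bl; have := NX _ (root_shift_reflect Rb b0 Rc nE bl (root_shift0 rc)).
congr zspan; apply: functional_extensionality => h.
by rewrite /fscale /faddz /fzero rmorphM; ring.
Qed.

(** Commensurability spreads between nonorthogonal elements, so the elements that have it are
    orthogonal to those that do not. Irreducibility leaves no room for the latter, since [a] is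
    among the former. *)
Lemma root_shift_all_commensurable a b : List.In a Rd -> root_x a -> List.In b Rd -> b <> fzero ->
  commensurable (root_shift b) (root_shift a).
Proof.
move=> Ra rxa Rb b0.
have a0 : a <> fzero by move=> a0; apply: (@lam_not_root_x fzero); [exact: zspan0|rewrite -a0].
(* The property is asked of a multiple of [c] that is a root, as [c] itself need not be one. *)
pose P c := (List.In c Rd /\ c <> fzero) /\ exists k, k <> 0 /\ List.In (fscale k c) Rd /\
  root_x (fscale k c) /\ commensurable (root_shift (fscale k c)) (root_shift a).
pose Q c := (List.In c Rd /\ c <> fzero) /\ ~ P c.
have Pb : P b.
  apply: NNPP => nPb; case: hRd => _ [+ _]; apply; exists P, Q.
  split; last split; last split; last split.
  - by move=> c; split=> [Rc|[[]|[]] //]; case: (classic (P c)) => [|nPc]; [left|right].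
  - by move=> c [Pc []].
  - exists a; split=> //; exists 1; have -> : fscale 1 a = a by fext; rewrite /fscale mul1r.
    split; first by apply/eqP; exact: oner_neq0.
    split=> //; split=> //; exists 1; split=> // l al; apply: zspan_gen.
    by have -> : fscale 1%:~R l = l by fext; rewrite /fscale mul1r.
  - by exists b.
  move=> c d [[Rc c0] [k [/eqP k0 [Rk [rk ck]]]]] [[Rd' d0] nPd].
  apply: NNPP => /eqP cd; apply: nPd; split=> //.
  have [k' [/eqP k'0 [Rk' rk']]] := Rd_root_multiple Rd' d0.
  exists k'; split; first exact/eqP.
  split=> //; split=> //; apply: (@root_shift_commensurable _ (fscale k c)) => //.
    by move=> E; case: rk' => _; apply; rewrite E dformE //; apply: (Rd_lin Rd_zero).
  rewrite dform_scalel ?dform_scaler; try exact: Rd_lin.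
  by apply/eqP; rewrite !mulf_neq0.
case: Pb => _ [k [/eqP k0 [Rk [rk ck]]]].
apply: (@root_shift_commensurable _ (fscale k b)) => //.
rewrite dform_scalel; last exact: Rd_lin.
by apply/eqP; rewrite mulf_neq0 //; apply/eqP; apply: Rd_anisotropic.
Qed.

Lemma lam_commensurable a : List.In a Rd -> root_x a -> commensurable Lam_t (root_shift a).
Proof.
move=> Ra rxa.
have [N [N0 NP]] : exists N : int, N <> 0 /\ forall b, List.In b Rd -> b <> fzero ->
    forall l, root_shift b l -> zspan (root_shift a) (fscale N%:~R l).
  have: forall b, List.In b Rd -> b <> fzero -> commensurable (root_shift b) (root_shift a).
    by move=> b Rb b0; apply: root_shift_all_commensurable.
  elim: (Rd) => [|b s IH] sP; first by exists 1.
  have [|N [N0 NP]] := IH; first by move=> c sc; apply: sP; right.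
  case: (classic (b = fzero)) => [bE|b0].
    by exists N; split=> // c [<- //|]; apply: NP.
  have [M [M0 MP]] := sP b (or_introl erefl) b0.
  exists (N * M); split; first by apply/eqP; rewrite mulf_neq0 //; apply/eqP.
  move=> c [<- _ l bl|sc c0 l cl].
    have -> : fscale (N * M)%:~R l = fscale N%:~R (fscale M%:~R l).
      by fext; rewrite /fscale rmorphM mulrA.
    by apply: zspan_scale; apply: MP.
  have -> : fscale (N * M)%:~R l = fscale M%:~R (fscale N%:~R l).
    by fext; rewrite /fscale rmorphM mulrA (mulrC M%:~R).
  by apply: zspan_scale; apply: NP sc c0 _ _.
exists N; split=> // l; elim/zspan_ind => [|g k d IH [rd [c [rc rdc]]]].
  have -> : fscale N%:~R fzero = @fzero H by fext; rewrite /fscale mulr0.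
  exact: zspan0.
have [b [m [Rb [b0 [Lm cE]]]]] := root_x_decomp rc.
(* Writing c = b + m, both m and d + m lie in S_b, because c and d + c are roots. Their difference
   is d, so the common multiplier [N] for all of [Rd] also works for d. *)
have Ld : Lam_t d by apply: zspan_gen; split=> //; exists c.
have bm : root_shift b m by split=> //; rewrite -cE; case: rc.
have bdm : root_shift b (fadd d m).
  split; first exact: zspanD.
  have -> : fadd b (fadd d m) = fadd d c by rewrite cE; fext; ring.
  exact: rdc.
have -> : fscale N%:~R (faddz g k d) = faddz (fscale N%:~R g) k
    (fsub (fscale N%:~R (fadd d m)) (fscale N%:~R m)).
  by fext; rewrite /fscale /faddz; ring.
apply: zspan_add => //; apply: zspanB; exact: NP Rb b0 _ _.
Qed.

(** Since the Cartan integer of [a] with itself is 2, reflection shows that S_a is closed under m -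
    2u. It contains 0, and u - 2u = - u gives both signs, so every doubled integer combination is
    reached by successive steps. *)
Lemma root_shift_double a l : List.In a Rd -> root_x a -> zspan (root_shift a) l ->
  root_shift a (fscale 2%:~R l).
Proof.
move=> Ra rxa.
have a0 : a <> fzero by move=> a0; apply: (@lam_not_root_x fzero); [exact: zspan0|rewrite -a0].
have aa : cartan dform a a = 2%:~R by rewrite cartan_self.
have dbl m u : root_shift a m -> root_shift a u -> root_shift a (faddz m (-2) u).
  by move=> am au; apply: (root_shift_reflect Ra a0 Ra aa au am).
have opp u : root_shift a u -> root_shift a (fopp u).
  by move=> au; have := dbl u u au au; congr root_shift; fext; rewrite /faddz rmorphN; ring.
elim/zspan_ind => [|g k u ag au].
  by have -> : fscale 2%:~R fzero = @fzero H by [fext; rewrite /fscale mulr0]; apply: root_shift0.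
have nat_step (n : nat) v : root_shift a v ->
    root_shift a (faddz (fscale 2%:~R g) (2 * - Posz n) v).
  move=> av; elim: n => [|n IH].
    by have -> : faddz (fscale 2%:~R g) (2 * - Posz 0) v = fscale 2%:~R g by
      [fext; rewrite /faddz mulr0 mul0r addr0].
  have := dbl _ _ IH av; congr root_shift; fext; rewrite /faddz /fscale.
  by rewrite -[n.+1]addn1 PoszD !rmorphM !rmorphN !rmorphD /=; ring.
have -> : fscale 2%:~R (faddz g k u) = faddz (fscale 2%:~R g) (2 * k) u.
  by fext; rewrite /faddz /fscale rmorphM; ring.
case: k => n; last first.
  by rewrite NegzE; apply: nat_step.
have := nat_step n (fopp u) (opp _ au); congr root_shift; fext; rewrite /faddz.
by rewrite !rmorphM rmorphN /=; ring.
Qed.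

(** For g in Lam_t, a + 2N g is a root. If g is smaller than e / |2N| at the points of [F], this
    root is within e of [a] there, so it equals [a] and g = 0. *)
Lemma Lam_t_free : free_finite_rank Lam_t.
Proof.
have [a [Ra rxa]] : exists a, List.In a Rd /\ root_x a.
  have [c rc] := root_x_nonempty; have [b [l [Rb [b0 _]]]] := root_x_decomp rc.
  by have [k [_ [Rk rk]]] := Rd_root_multiple Rb b0; exists (fscale k b).
have [N [N0 NP]] := lam_commensurable Ra rxa.
have [F [e [e0 disc]]] := root_discrete (proj1 rxa).
have N2 : (2 * N)%:~R != 0 :> C.
  by rewrite intr_eq0 mulf_neq0 //; apply/eqP.
apply: (@discrete_free_finite_rank H Lam_t _ F (e / `|(2 * N)%:~R|)).
- by move=> f k g; apply: zspan_add.
- exact: zspan0.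
- by rewrite divr_gt0 // normr_gt0.
move=> g Lg small.
have [_ rg] := root_shift_double Ra rxa (NP g Lg).
have E : fadd a (fscale 2%:~R (fscale N%:~R g)) = a.
  apply: disc => // h Fh; have := small h Fh.
  rewrite ltr_pdivlMr ?normr_gt0 // -normrM /fadd /fscale addrC addKr.
  by rewrite mulrA -rmorphM mulrC.
apply: functional_extensionality => h.
have := congr1 (fun u => u h) E.
rewrite /fadd /fscale /fzero -[X in _ = X]addr0 => /addrI/eqP.
by rewrite mulrA -rmorphM mulf_eq0 (negbTE N2) => /eqP.
Qed.

(** * The grading of the core modulo its centre *)

Variables (L : lmodType C) (brL : L -> L -> L) (pi : G -> L).
Hypothesis hpi : is_core_mod_center br B iota brL pi.

Lemma pi_lin : lin_map pi.
Proof. by case: hpi => _ []. Qed.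
Lemma pi_br x y : core x -> core y -> pi (br x y) = brL (pi x) (pi y).
Proof. by case: hpi => _ [_ [pb _]]; apply: pb. Qed.
Lemma pi_surj u : exists x, core x /\ pi x = u.
Proof. by case: hpi => _ [_ [_ [ps _]]]; apply: ps. Qed.
Lemma pi_ker x : core x -> (pi x = 0 <-> core_center x).
Proof. by case: hpi => _ [_ [_ [_ pk]]]; apply: pk. Qed.

Definition grade a l (u : L) := exists x, core x /\ rootsp (fadd a l) x /\ u = pi x.

Lemma grade_root_vector a l x : root_x (fadd a l) -> rootsp (fadd a l) x -> grade a l (pi x).
Proof. by move=> ra xa; exists x; split=> //; apply: core_gen xa. Qed.

Lemma pi_root_vector_neq0 a x : root_x a -> rootsp a x -> x <> 0 -> pi x <> 0.
Proof.
move=> ra xa x0 /pi_ker; move/(_ (core_gen ra xa)); exact: root_vector_not_central xa x0.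
Qed.

Lemma grade_subsp a l : subsp (grade a l).
Proof.
split=> [|k u v [x [cx [xa ->]]] [y [cy [ya ->]]]].
  exists 0; rewrite (lin_map0 pi_lin); do !split=> //; first exact: (subsp0 core_subsp).
  exact: (subsp0 (rootsp_subsp _)).
exists (k *: x + y); rewrite pi_lin; split; first exact: (proj2 core_subsp).
by split=> //; apply: (proj2 (rootsp_subsp _)).
Qed.

Lemma grade_neq0 a l u : Qd a -> Lam_t l -> grade a l u -> u <> 0 -> root_t (fadd a l).
Proof.
move=> Qa Ll [x [cx [xa ->]]] u0; apply: core_weight cx xa _ => x0.
by apply: u0; rewrite x0 (lin_map0 pi_lin).
Qed.

Lemma grade_neq0_root_x a l u : Qd a -> a <> fzero -> Lam_t l -> grade a l u -> u <> 0 ->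
  root_x (fadd a l).
Proof. by move=> Qa a0 Ll gu u0; apply: root_t_root_x => //; apply: grade_neq0 gu u0. Qed.

Lemma grade_br a b l m u v : grade a l u -> grade b m v ->
  grade (fadd a b) (fadd l m) (brL u v).
Proof.
move=> [x [cx [xa ->]]] [y [cy [yb ->]]]; exists (br x y); rewrite pi_br //.
split; first exact: core_br.
split=> //; have -> : fadd (fadd a b) (fadd l m) = fadd (fadd a l) (fadd b m) by fext; ring.
exact: rootsp_br.
Qed.

Lemma grade_lift (s : seq (((H -> C) * (H -> C)) * L)) :
  (forall p, List.In p s -> grade p.1.1 p.1.2 p.2) ->
  exists t : seq ((H -> C) * G), (forall q, List.In q t -> core q.2 /\ rootsp q.1 q.2 /\
     exists p, List.In p s /\ q.1 = fadd p.1.1 p.1.2) /\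
  pi (\sum_(q <- t) q.2) = \sum_(p <- s) p.2.
Proof.
elim: s => [|p s IH] gs; first by exists [::]; rewrite !big_nil (lin_map0 pi_lin).
have [|t [tc tE]] := IH; first by move=> q qs; apply: gs; right.
have [x [cx [xa pE]]] := gs p (or_introl erefl).
exists ((fadd p.1.1 p.1.2, x) :: t); rewrite !big_cons (lin_mapD pi_lin) tE -pE; split=> //.
move=> q [<-|/tc [cq [rq [r [rs rE]]]]].
  by split=> //; split=> //; exists p; split=> //; left.
by split=> //; split=> //; exists r; split=> //; right.
Qed.

Lemma core_annihilator_subsp :
  subsp (fun x => forall b y, root_x b -> rootsp b y -> br x y = 0).
Proof.
split=> [b y _ _|k x y xc yc b z rb zb]; first by rewrite (lin_map0 (br_linl _)).
by rewrite br_linl (xc b z) // (yc b z) // scaler0 addr0.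
Qed.

(** A relation in the quotient lifts to a central sum in the core. Its component of the weight of
    [p] is then central too, as the annihilator of the root vectors is graded, and so becomes 0 in
    the quotient. *)
Lemma grade_independent (s : seq (((H -> C) * (H -> C)) * L)) :
  List.NoDup (map fst s) ->
  (forall p, List.In p s -> (Qd p.1.1 /\ Lam_t p.1.2) /\ grade p.1.1 p.1.2 p.2) ->
  \sum_(p <- s) p.2 = 0 -> forall p, List.In p s -> p.2 = 0.
Proof.
move=> nd gs s0 p /(@List.in_split _ _ _) [s1 [s2 sE]]; subst s.
have gp : List.In p (s1 ++ p :: s2) by apply/List.in_or_app; right; left.
have gin q : List.In q (s1 ++ s2) -> List.In q (s1 ++ p :: s2).
  by case/(@List.in_app_or _ _ _ _) => qs; apply/List.in_or_app; [left|right; right].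
have [[Qp Lp] [x [cx [xp pE]]]] := gs p gp.
have [|t [tc tE]] := @grade_lift (s1 ++ s2); first by move=> q /gin /gs [].
have t_core : core (\sum_(q <- t) q.2) by apply: (subsp_sum core_subsp) => q /tc [].
have pi0 : pi (x + \sum_(q <- t) q.2) = 0.
  by rewrite (lin_mapD pi_lin) tE -pE -[RHS]s0 !big_cat big_cons /= addrCA.
have cen : core_center (x + \sum_(q <- t) q.2).
  by apply/pi_ker => //; apply: (subspD core_subsp).
have ann := proj1 (core_centerP (subspD core_subsp cx t_core)) cen.
rewrite pE; apply/pi_ker => //; apply/core_centerP => //.
apply: (@weight_component H G (fun h => br (iota h))
  (fun x => forall b y, root_x b -> rootsp b y -> br x y = 0) (fadd p.1.1 p.1.2) _ t) => //.
- by move=> h; apply: br_linr.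
- exact: core_annihilator_subsp.
- by move=> h u; apply: adH_centralizer_stable.
(* The other weights are different: by directness of the sum, equal weights would mean equal index
   pairs, against [NoDup]. *)
move=> q /tc [_ [qw [r [rs qE]]]]; split=> //; rewrite qE => E.
have [[Qr Lr] _] := gs r (gin r rs).
have [E1 E2] := Qd_lam_inj Qr Qp Lr Lp E.
have rp : r.1 = p.1 by move: E1 E2; case: (r.1) (p.1) => [u v] [u' v'] /= -> ->.
have : List.In p.1 (map fst (s1 ++ s2)) by rewrite -rp; apply: List.in_map.
by rewrite map_cat; move: nd; rewrite map_cat; apply: List.NoDup_remove_2.
Qed.

Lemma grade_span u : exists s : seq (((H -> C) * (H -> C)) * L),
  (forall p, List.In p s -> (Qd p.1.1 /\ Lam_t p.1.2) /\ grade p.1.1 p.1.2 p.2) /\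
  u = \sum_(p <- s) p.2.
Proof.
have [x [/core_atom_span [s [sa ->]] <-]] := pi_surj u.
elim: s sa => [|q s IH] sa; first by exists [::]; rewrite !big_nil (lin_map0 pi_lin).
have [|t [tc tE]] := IH; first by move=> r rs; apply: sa; right.
have qa := sa q (or_introl erefl).
have [b [l [Rb [Ll qE]]]] := root_t_decomp (atom_root_t qa).
exists (((b, l), pi q.2) :: t); rewrite !big_cons (lin_mapD pi_lin) -tE; split=> //.
move=> r [<-|/tc //]; split; first by split=> //; apply: zspan_gen.
exists q.2; split; first exact: atom_core qa.
by split=> //=; rewrite -qE; apply: atom_rootsp.
Qed.

Lemma grade_dim_le1 a l : List.In a Rd -> a <> fzero -> Lam_t l -> dim_le1 (grade a l).
Proof.
move=> Ra a0 Ll; have Qa : Qd a by apply: zspan_gen.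
case: (classic (exists u, grade a l u /\ u <> 0)) => [[u [gu u0]]|none]; last first.
  exists 0 => v gv; exists 0; rewrite scale0r; apply: NNPP => v0; apply: none.
  by exists v.
have rx := grade_neq0_root_x Qa a0 Ll gu u0.
case: gu u0 => x [cx [xa ->]] u0.
have x0 : x <> 0 by move=> x0; apply: u0; rewrite x0 (lin_map0 pi_lin).
exists (pi x) => v [y [cy [ya ->]]]; have [k ->] := root_x_dim1 rx xa ya x0.
by exists k; rewrite (lin_mapZ pi_lin).
Qed.

Lemma grade_zero_dim_eq1 a : List.In a Rd -> a <> fzero -> ~ List.In (fhalf a) Rd ->
  dim_eq1 (grade a fzero).
Proof.
move=> Ra a0 nh; split; first by apply: grade_dim_le1 => //; apply: zspan0.
have aE : fadd a fzero = a by fext; rewrite addr0.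
have rx : root_x a by case: hRd => _ [_ [_ [ir _]]]; case: (ir a Ra nh).
have [x [x0 xa]] := proj1 rx.
exists (pi x); split; first by apply: grade_root_vector; rewrite aE.
exact: pi_root_vector_neq0 rx xa x0.
Qed.

Lemma grade_sl2 a l : List.In a Rd -> a <> fzero -> Lam_t l -> dim_eq1 (grade a l) ->
  exists e f : L, grade a l e /\ grade (fopp a) (fopp l) f /\ grade fzero fzero (brL e f) /\
    forall b m u, List.In b Rd -> Lam_t m -> grade b m u ->
      brL (brL e f) u = cartan dform b a *: u.
Proof.
move=> Ra a0 Ll [_ [u [gu u0]]]; have Qa : Qd a by apply: zspan_gen.
have rx := grade_neq0_root_x Qa a0 Ll gu u0.
case: gu u0 => x [cx [xa ->]] u0.
have x0 : x <> 0 by move=> x0; apply: u0; rewrite x0 (lin_map0 pi_lin).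
have [f [fa [_ act]]] := sl2_triple rx xa x0.
have oE : fopp (fadd a l) = fadd (fopp a) (fopp l) by fext; ring.
have cf : core f by apply: core_gen fa; apply: rootx_opp.
have ge : grade a l (pi x) by exists x.
have gf : grade (fopp a) (fopp l) (pi f) by exists f; rewrite -oE.
exists (pi x), (pi f); do 2!split=> //; split.
  have := grade_br ge gf.
  have zE (c : H -> C) : fadd c (fopp c) = fzero by fext; rewrite subrr.
  by rewrite !zE.
move=> b m _ Rb Lm [y [cy [yb ->]]].
rewrite -pi_br // -pi_br //; last exact: core_br.
by rewrite (act _ _ yb) (lin_mapZ pi_lin) cartan_shift.
Qed.

(** For the nontrivial direction, an atom whose weight lies in Lam_t cannot be a nonisotropic root
    vector, so it is a bracket of two such vectors. If the first has weight b' + m, the second has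
    weight - b' + (l - m). *)
Lemma grade_zero l u : Lam_t l -> grade fzero l u <->
  exists s : seq (((H -> C) * (H -> C)) * (L * L)),
    (forall p, List.In p s -> List.In p.1.1 Rd /\ p.1.1 <> fzero /\ Lam_t p.1.2 /\
       grade p.1.1 p.1.2 p.2.1 /\ grade (fopp p.1.1) (fsub l p.1.2) p.2.2) /\
    u = \sum_(p <- s) brL p.2.1 p.2.2.
Proof.
move=> Ll; split; last first.
  move=> [s [sP ->]]; apply: (subsp_sum (grade_subsp _ _)) => p ps.
  have [_ [_ [_ [g1 g2]]]] := sP p ps; have := grade_br g1 g2.
  have -> : fadd p.1.1 (fopp p.1.1) = fzero by fext; rewrite subrr.
  by have -> : fadd p.1.2 (fsub l p.1.2) = l by fext; ring.
have zE : fadd fzero l = l by fext; rewrite add0r.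
move=> [x [cx [xl ->]]]; have [s [sa ->]] := core_component cx xl.
elim: s sa => [|y s IH] sa; first by exists [::]; rewrite !big_nil (lin_map0 pi_lin).
have [|t [tP tE]] := IH; first by move=> z zs; apply: sa; right.
have [[]|[b [c [v [w [rb [rc [vb [wc [_ [lE yE]]]]]]]]]]] := sa y (or_introl erefl).
  by rewrite zE => /(lam_not_root_x Ll).
have [b' [m [Rb [b0 [Lm bE]]]]] := root_x_decomp rb.
have [c' [n [Rc [c0 [Ln cE]]]]] := root_x_decomp rc.
exists (((b', m), (pi v, pi w)) :: t); rewrite !big_cons (lin_mapD pi_lin) tE yE /=.
rewrite (pi_br (core_gen rb vb) (core_gen rc wc)).
split=> // p [<-|/tP //] /=; do 3!split=> //.
split; first by exists v; rewrite -bE; split=> //; apply: core_gen vb.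
exists w; split; first exact: core_gen wc.
split=> //; have -> : fadd (fopp b') (fsub l m) = c => //.
apply: functional_extensionality => h; have := congr1 (fun q => q h) lE.
by rewrite bE /fadd /fopp /fsub /fzero add0r => ->; ring.
Qed.

(** A generator d, with d + a a root for a nonisotropic a = b + m, is the difference of d + m and m.
    Both are in the support, through nonzero vectors of degree [b]: d + a is nonisotropic because
    adding d preserves the norm of a. *)
Lemma Lam_t_support l : Lam_t l <->
  zspan (fun m => Lam_t m /\ exists a u, List.In a Rd /\ grade a m u /\ u <> 0) l.
Proof.
split; last first.
  elim/zspan_ind => [|g k u Lg [Lu _]]; first exact: zspan0.
  exact: zspan_add.
apply: zspan_sub => d rt; have Ld : Lam_t d by apply: zspan_gen.
case: rt => rd [a [ra rda]].
have [b [m [Rb [b0 [Lm aE]]]]] := root_x_decomp ra.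
have supp m' : Lam_t m' -> root_x (fadd b m') ->
    exists a u, List.In a Rd /\ grade a m' u /\ u <> 0.
  move=> Lm' rb; have [x [x0 xb]] := proj1 rb.
  exists b, (pi x); split=> //; split; first exact: grade_root_vector.
  exact: pi_root_vector_neq0 rb xb x0.
have dE : fadd b (fadd d m) = fadd d a by rewrite aE; fext; ring.
have -> : d = fsub (fadd d m) m by fext; ring.
have Ldm : Lam_t (fadd d m) by apply: zspanD.
apply: zspanB; apply: zspan_gen; split=> //; apply: supp => //; last by rewrite -aE.
by rewrite dE; split=> //; rewrite root_x_shift //; case: ra.
Qed.

Lemma core_mod_center_lie_torus : lie_torus dform Rd Lam_t brL.
Proof.
split; first exact: Lam_t_free.
exists grade; split; first exact: grade_subsp.
split; first by split=> [u|s nd gs s0]; [exact: grade_span | exact: grade_independent].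
split; first by move=> *; apply: grade_br.
split.
  move=> a l u Qa Ll nRa gu; apply: NNPP => u0; apply: nRa.
  exact: root_t_in_Rd Qa Ll (grade_neq0 Qa Ll gu u0).
split.
  move=> a l Ra a0 Ll; split; first exact: grade_dim_le1.
  by split; [exact: grade_zero_dim_eq1 | exact: grade_sl2].
split; last exact: Lam_t_support.
by move=> l Ll u; apply: grade_zero.
Qed.

End Lie.

Theorem theorem3p1 (G : lmodType C) (H : vectType C) (br : G -> G -> G)
    (B : G -> G -> C) (iota : H -> G) (Rd : seq (H -> C))
    (L : lmodType C) (brL : L -> L -> L) (pi : G -> L) :
  is_GRLA br B iota ->
  indecomposable br B iota ->
  Rdot_ok br B iota Rd ->
  is_core_mod_center br B iota brL pi ->
  lie_torus (dform B iota) Rd (Lam_t br B iota) brL.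
Proof. by move=> hG _ hRd hpi; apply: (core_mod_center_lie_torus hG hRd hpi). Qed.
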